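(* Let $\alpha\ge 1$ be an integer, let $M\ge\sqrt{\alpha}\ (\ge 1)$, and let $F(z)=\sum_{k=0}^{\alpha-1}\bar z^kA_k(z)$ be a polyanalytic function of order $\alpha$ on $\mathbb{D}$, where $A_k\in\mathcal{A}$ and $A_k(z)=\sum_{n=0}^\infty a_{n,k}z^n$ for each $k\in\{0,\ldots,\alpha-1\}$. Suppose that all non-zero coefficients $a_{n_1,k_1},a_{n_2,k_2}$ satisfy $\left|\arg\frac{a_{n_1,k_1}}{a_{n_2,k_2}}\right|\le\frac{\pi}{2}$ for all $k_1,k_2\in\{0,\ldots,\alpha-1\}$ and $n_1,n_2\in\mathbb{N}$ with $k_1\ne k_2$, $n_1\ne n_2$. If $|F(z)|\le M$ for all $z\in\mathbb{D}$, then $F$ is univalent in the disk $\mathbb{D}_{r_1}$ and $F(\mathbb{D}_{r_1})$ contains a schlicht disk $\mathbb{D}_{\sigma_1}$, where $r_1$ is the least positive root of the equation $$2-\frac{1-(\alpha+1)r^\alpha+\alpha r^{\alpha+1}}{(1-r)^2}-\frac{r\sqrt{M^2-\alpha}}{(1-r)^3}\Big[2+r^\alpha\{\alpha r-(\alpha+2)\}\Big]=0$$ and $$\sigma_1=r_1-\frac{r_1^2-r_1^{\alpha+1}}{1-r_1}-\sqrt{M^2-\alpha}\,\frac{(1-r_1^\alpha)r_1^2}{(1-r_1)^2}.$$ In particular, if $|F(z)|\le 1$ for all $z\in\mathbb{D}$, then $F$ is univalent and maps $\mathbb{D}$ onto $\mathbb{D}$.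
   Context: $\mathbb{N}=\{1,2,\ldots\}$; $\mathbb{D}$ is the open unit disk in $\mathbb{C}$ and $\mathbb{D}_r=\{z:|z|<r\}$. A continuous function $F:\Omega\to\mathbb{C}$ on a domain $\Omega\subseteq\mathbb{C}$ is polyanalytic of order $\alpha$ if $\partial^\alpha F/\partial\bar z^\alpha=0$ on $\Omega$; equivalently $F(z)=\sum_{k=0}^{\alpha-1}\bar z^kA_k(z)$ with each $A_k$ analytic in $\Omega$. $\mathcal{A}$ is the set of analytic functions $g$ on $\mathbb{D}$ with $g(0)=0$, $g'(0)=1$. Univalent means injective. A schlicht disk in the range of $F$ is a disk which is the univalent image under $F$ of some region. $\arg$ denotes the principal argument in $(-\pi,\pi]$. *)

(* Defs.v *)
From Stdlib Require Import Reals.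
From Coquelicot Require Import Coquelicot.

Open Scope R_scope.

Definition disk (r : R) (z : C) : Prop := Cmod z < r.

(* Complex differentiability, i.e. the base field is C, not R. *)
Definition analytic_on (D : C -> Prop) (g : C -> C) : Prop :=
  forall z : C, D z -> ex_derive (K := C_AbsRing) (V := C_NormedModule) g z.

Definition classA (g : C -> C) : Prop :=
  analytic_on (disk 1) g /\
  g (RtoC 0) = (RtoC 0) /\
  is_derive (K := C_AbsRing) (V := C_NormedModule) g (RtoC 0) (RtoC 1).

(* Principal argument, with values in (-PI, PI]; only meaningful for z <> 0. *)
Definition Arg (z : C) : R :=
  if Rle_dec 0 (Im z) then acos (Re z / Cmod z) else - acos (Re z / Cmod z).

Definition univalent_on (D : C -> Prop) (f : C -> C) : Prop :=
  forall z w : C, D z -> D w -> f z = f w -> z = w.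

Definition maps_onto (f : C -> C) (D E : C -> Prop) : Prop :=
  forall w : C, E w <-> exists z : C, D z /\ f z = w.

(* For an open set it is enough to consider separations by open sets of the
   plane that are disjoint inside U. *)
Definition connected_open (U : C -> Prop) : Prop :=
  forall V W : C -> Prop, open V -> open W ->
    (forall z, U z -> V z \/ W z) ->
    (forall z, U z -> ~ (V z /\ W z)) ->
    (forall z, U z -> V z) \/ (forall z, U z -> W z).

Definition region (U : C -> Prop) : Prop :=
  (exists z : C, U z) /\ open U /\ connected_open U.

(* f(D) contains the schlicht disk {|w| < s}. *)
Definition image_contains_schlicht_disk
    (f : C -> C) (D : C -> Prop) (s : R) : Prop :=
  0 < s /\
  exists U : C -> Prop,
    region U /\ (forall z, U z -> D z) /\
    univalent_on U f /\ maps_onto f U (disk s).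

(* At r = 1 both numerators vanish, so the totalized expression is 2 there
   and the convention for division by 0 creates no spurious root. *)
Definition radius_fun (alpha : nat) (M r : R) : R :=
  2 - (1 - (INR alpha + 1) * r ^ alpha + INR alpha * r ^ (alpha + 1))
      / (1 - r) ^ 2
    - r * sqrt (M ^ 2 - INR alpha) / (1 - r) ^ 3
      * (2 + r ^ alpha * (INR alpha * r - (INR alpha + 2))).

Definition least_positive_root (f : R -> R) (r : R) : Prop :=
  0 < r /\ f r = 0 /\ forall s : R, 0 < s -> f s = 0 -> r <= s.

Definition schlicht_radius (alpha : nat) (M r : R) : R :=
  r - (r ^ 2 - r ^ (alpha + 1)) / (1 - r)
    - sqrt (M ^ 2 - INR alpha) * ((1 - r ^ alpha) * r ^ 2 / (1 - r) ^ 2).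

(* Main.v *)
Require Import Defs.
From Stdlib Require Import Reals Ranalysis5 Lra Lia Psatz ClassicalEpsilon.
From Coquelicot Require Import Coquelicot.

Open Scope R_scope.

(** Why the theorem is true.  Write alpha = b + 1 and N = sqrt (M^2 - alpha).

    On the circle |z| = r the function F is a Fourier series in which
    a_(n,k) r^(n+k) contributes to the frequency n - k.  Two coefficients with
    k1 <> k2 that share a frequency have n1 <> n2, so the hypothesis on the
    arguments says that they form an angle of at most PI / 2, and the
    cross terms in the mean of |F|^2 are nonnegative.  Hence the sum of all
    |a_(n,k)|^2 r^(2(n+k)) is at most M^2; letting r tend to 1 and using
    a_(1,k) = 1 for all alpha values of k gives alpha + |a_(n,k)|^2 <= M^2
    for n >= 2 ([coef_square_bound]), that is |a_(n,k)| <= N.  The mean is taken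
    over roots of unity and not by integration: F is first replaced by a
    truncation of its series, uniformly close to it on the circle
    ([truncation_uniform]), and for a trigonometric polynomial the mean over
    sufficiently many roots of unity is exact ([parseval_le]).

    These coefficient bounds make F a perturbation of the identity.  Since
    z^n (conj z)^k is (n+k) rho^(n+k-1)-Lipschitz on |z| <= rho, the map
    F - id is Lipschitz there with constant [lip_bound] and bounded by
    [sup_bound].  The radius equation is exactly 1 - lip_bound = 0
    ([radius_fun_lip]), and sigma_1 is r_1 - sup_bound r_1
    ([schlicht_radius_sup]).  So for rho < r_1 the map F - id is a contraction
    of the closed disk of radius rho: F is injective there, and F z = w is
    solved by iterating z |-> w - (F z - z), which maps the closed disk of
    radius r_1 - sigma_1 + |w| to itself ([perturbed_id_solve]).  The
    inverse is locally Lipschitz, whence the preimage of the disk of radius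
    sigma_1 is a region ([perturbed_id_schlicht]).

    If |F| <= 1 the coefficient inequality forces alpha = 1 and a_(n,0) = 0
    for n >= 2, so F is the identity. *)

(** * Finite sums of real numbers *)

Lemma sum_n_SR (f : nat -> R) n : sum_n f (S n) = sum_n f n + f (S n).
Proof. exact (sum_Sn f n). Qed.

Lemma sum_n_le_loc (f g : nat -> R) n :
  (forall k, (k <= n)%nat -> f k <= g k) -> sum_n f n <= sum_n g n.
Proof.
  induction n as [|n IH]; intros H.
  - rewrite !sum_O. apply H; lia.
  - rewrite !sum_n_SR. apply Rplus_le_compat; [apply IH; intros; apply H; lia | apply H; lia].
Qed.

Lemma sum_n_lt_loc (f g : nat -> R) n i :
  (forall k, (k <= n)%nat -> f k <= g k) -> (i <= n)%nat -> f i < g i ->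
  sum_n f n < sum_n g n.
Proof.
  induction n as [|n IH]; intros H Hi Hlt.
  - rewrite !sum_O. replace i with 0%nat in Hlt by lia; exact Hlt.
  - rewrite !sum_n_SR. destruct (Nat.eq_dec i (S n)) as [->|Hne].
    + apply Rplus_le_lt_compat; [apply sum_n_le_loc; intros; apply H; lia | exact Hlt].
    + apply Rplus_lt_le_compat; [apply IH; [intros; apply H; lia | lia | exact Hlt] | apply H; lia].
Qed.

Lemma sum_n_ge0 (f : nat -> R) n :
  (forall k, (k <= n)%nat -> 0 <= f k) -> 0 <= sum_n f n.
Proof.
  intros H. induction n as [|n IH]; [rewrite sum_O; apply H; lia|].
  rewrite sum_n_SR. apply Rplus_le_le_0_compat; [apply IH; intros; apply H; lia | apply H; lia].
Qed.

Lemma sum_n_ge_term (f : nat -> R) n i :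
  (forall k, (k <= n)%nat -> 0 <= f k) -> (i <= n)%nat -> f i <= sum_n f n.
Proof.
  induction n as [|n IH]; intros H Hi.
  - rewrite sum_O. replace i with 0%nat by lia; lra.
  - rewrite sum_n_SR. destruct (Nat.eq_dec i (S n)) as [->|Hne].
    + assert (0 <= sum_n f n) by (apply sum_n_ge0; intros; apply H; lia). lra.
    + assert (f i <= sum_n f n) by (apply IH; [intros; apply H; lia | lia]).
      assert (0 <= f (S n)) by (apply H; lia). lra.
Qed.

Lemma sum_n_ge_two_terms (f : nat -> R) n i j :
  (forall k, (k <= n)%nat -> 0 <= f k) -> (i < j <= n)%nat -> f i + f j <= sum_n f n.
Proof.
  induction n as [|n IH]; intros H Hi; [lia|].
  rewrite sum_n_SR. destruct (Nat.eq_dec j (S n)) as [->|Hne].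
  - apply Rplus_le_compat_r. apply sum_n_ge_term; [intros; apply H; lia | lia].
  - assert (f i + f j <= sum_n f n) by (apply IH; [intros; apply H; lia | lia]).
    assert (0 <= f (S n)) by (apply H; lia). lra.
Qed.

(** * Tails of the geometric series and of its derivative *)

(** The closed form of the sum of x^j over j >= p. *)
Definition tail (p : nat) (x : R) : R := x ^ p / (1 - x).
(** The closed form of the sum of (j+1) x^j over j >= p, the derivative of
    [tail (S p)]. *)
Definition dtail (p : nat) (x : R) : R :=
  INR (S p) * x ^ p / (1 - x) + x ^ S p / (1 - x) ^ 2.

Lemma tail_step p x : x <> 1 -> tail p x = x ^ p + tail (S p) x.
Proof. intros H. unfold tail. simpl. field. lra. Qed.

Lemma dtail_step p x : x <> 1 -> dtail p x = INR (S p) * x ^ p + dtail (S p) x.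
Proof. intros H. unfold dtail. rewrite (S_INR (S p)). simpl pow. field. lra. Qed.

Lemma tail_ge0 p x : 0 <= x < 1 -> 0 <= tail p x.
Proof.
  intros H. unfold tail. apply Rmult_le_pos; [apply pow_le; lra|].
  left; apply Rinv_0_lt_compat; lra.
Qed.

Lemma pow_le_1 x n : 0 <= x <= 1 -> 0 <= x ^ n <= 1.
Proof.
  intros H. split; [apply pow_le; lra|].
  rewrite <- (pow1 n). apply pow_incr; exact H.
Qed.

Lemma inv_one_minus_incr x y : 0 <= x <= y -> y < 1 -> / (1 - x) <= / (1 - y).
Proof. intros H Hy. apply Rinv_le_contravar; lra. Qed.

Lemma tail_incr p x y : 0 <= x <= y -> y < 1 -> tail p x <= tail p y.
Proof.
  intros H Hy. unfold tail. apply Rmult_le_compat.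
  - apply pow_le; lra.
  - left; apply Rinv_0_lt_compat; lra.
  - apply pow_incr; lra.
  - apply inv_one_minus_incr; lra.
Qed.

Lemma dtail_eq p x : x <> 1 ->
  dtail p x = INR (S p) * tail p x + tail (S p) x * / (1 - x).
Proof. intros H. unfold dtail, tail. field. lra. Qed.

Lemma dtail_ge0 p x : 0 <= x < 1 -> 0 <= dtail p x.
Proof.
  intros H. rewrite dtail_eq by lra.
  apply Rplus_le_le_0_compat; apply Rmult_le_pos; try apply tail_ge0; try apply pos_INR; try lra.
  left; apply Rinv_0_lt_compat; lra.
Qed.

Lemma dtail_incr p x y : 0 <= x <= y -> y < 1 -> dtail p x <= dtail p y.
Proof.
  intros H Hy. rewrite !dtail_eq by lra.
  apply Rplus_le_compat; apply Rmult_le_compat;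
    try apply tail_ge0; try apply tail_incr; try apply pos_INR; try lra.
  - left; apply Rinv_0_lt_compat; lra.
  - apply inv_one_minus_incr; lra.
Qed.

Lemma dtail_1_ge x : 0 <= x < 1 -> 2 * x / (1 - x) <= dtail 1 x.
Proof.
  intros H. unfold dtail. simpl INR. simpl pow.
  assert (0 <= x * (x * 1) / ((1 - x) * ((1 - x) * 1))).
  { apply Rmult_le_pos; [nra|]. left; apply Rinv_0_lt_compat; nra. }
  unfold Rdiv in *. rewrite Rmult_1_r. lra.
Qed.

Lemma dtail_1_lt x y : 0 <= x < y -> y < 1 -> dtail 1 x < dtail 1 y.
Proof.
  intros H Hy. unfold dtail. simpl INR.
  apply Rplus_lt_le_compat.
  - unfold Rdiv. apply Rlt_le_trans with ((1 + 1) * y ^ 1 * / (1 - x)).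
    + apply Rmult_lt_compat_r; [apply Rinv_0_lt_compat; lra | simpl; lra].
    + apply Rmult_le_compat_l; [simpl; lra | apply Rinv_le_contravar; lra].
  - unfold Rdiv. apply Rmult_le_compat.
    + apply pow_le; lra.
    + left; apply Rinv_0_lt_compat; simpl; nra.
    + apply pow_incr; lra.
    + apply Rinv_le_contravar; simpl; nra.
Qed.

(** Termwise this is p + 1 <= j + 1 for j >= p in x^(j+1). *)
Lemma dtail_tail p x : 0 <= x < 1 -> INR (S p) * tail (S p) x <= x * dtail p x.
Proof.
  intros H.
  assert (E : x * dtail p x - INR (S p) * tail (S p) x = x ^ 2 * x ^ p / (1 - x) ^ 2).
  { unfold dtail, tail. simpl pow. field. lra. }
  assert (0 <= x ^ 2 * x ^ p / (1 - x) ^ 2); [|lra].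
  apply Rmult_le_pos; [apply Rmult_le_pos; apply pow_le; lra|].
  left; apply Rinv_0_lt_compat; simpl; nra.
Qed.

(** * The radius equation *)

(** For |z| <= x, [lip_lead k] and [sup_lead k] are the Lipschitz constant and
    the bound of (conj z)^k z.  They vanish for k = 0 because that term is the
    identity, which the perturbation F - id does not contain. *)
Definition lip_lead (k : nat) (x : R) : R :=
  match k with O => 0 | S _ => INR (S k) * x ^ k end.
Definition sup_lead (k : nat) (x : R) : R :=
  match k with O => 0 | S _ => x ^ S k end.

(** The Lipschitz constant and the bound of F - id on |z| <= x when the
    coefficients a_(n,k) with n >= 2 have modulus at most N: the row k of F
    contributes (conj z)^k z and monomials of degrees k+2, k+3, ... *)
Definition lip_bound (b : nat) (N x : R) : R :=
  sum_n (fun k => lip_lead k x + N * dtail (S k) x) b.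
Definition sup_bound (b : nat) (N x : R) : R :=
  sum_n (fun k => sup_lead k x + N * tail (S (S k)) x) b.

(** The fractions of the radius equation are the summed up closed forms of the
    rows; x = 1 is excluded since the totalized quotients differ there. *)
Lemma radius_fun_lip b M x : x <> 1 ->
  radius_fun (S b) M x = 1 - lip_bound b (sqrt (M ^ 2 - INR (S b))) x.
Proof.
  intros Hx. unfold radius_fun, lip_bound.
  generalize (sqrt (M ^ 2 - INR (S b))) as N; intros N.
  induction b as [|b IH].
  - rewrite sum_O. unfold lip_lead, dtail. simpl INR. simpl pow. field. lra.
  - rewrite sum_n_SR.
    match type of IH with ?l = 1 - ?s => replace s with (1 - l) by lra end.
    unfold lip_lead, dtail. rewrite !Nat.add_1_r. rewrite !S_INR. simpl pow. field. lra.
Qed.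

Lemma schlicht_radius_sup b M x : x <> 1 ->
  schlicht_radius (S b) M x = x - sup_bound b (sqrt (M ^ 2 - INR (S b))) x.
Proof.
  intros Hx. unfold schlicht_radius, sup_bound.
  generalize (sqrt (M ^ 2 - INR (S b))) as N; intros N.
  induction b as [|b IH].
  - rewrite sum_O. unfold sup_lead, tail. simpl pow. field. lra.
  - rewrite sum_n_SR.
    match type of IH with ?l = x - ?s => replace s with (x - l) by lra end.
    unfold sup_lead, tail. rewrite !Nat.add_1_r. simpl pow. field. lra.
Qed.

Lemma lip_lead_incr k x y : 0 <= x <= y -> lip_lead k x <= lip_lead k y.
Proof.
  intros H. destruct k; [simpl; lra|]. unfold lip_lead.
  apply Rmult_le_compat_l; [apply pos_INR | apply pow_incr; lra].
Qed.

Lemma sup_lead_incr k x y : 0 <= x <= y -> sup_lead k x <= sup_lead k y.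
Proof. intros H. destruct k; [simpl; lra|]. apply pow_incr; lra. Qed.

Section Bounds.
Variables (b : nat) (N : R).
Hypothesis HN : 0 <= N.

Lemma lip_bound_incr x y : 0 <= x <= y -> y < 1 -> lip_bound b N x <= lip_bound b N y.
Proof.
  intros H Hy. apply sum_n_le_loc. intros k _. apply Rplus_le_compat.
  - apply lip_lead_incr; exact H.
  - apply Rmult_le_compat_l; [exact HN | apply dtail_incr; lra].
Qed.

Lemma sup_bound_incr x y : 0 <= x <= y -> y < 1 -> sup_bound b N x <= sup_bound b N y.
Proof.
  intros H Hy. apply sum_n_le_loc. intros k _. apply Rplus_le_compat.
  - apply sup_lead_incr; exact H.
  - apply Rmult_le_compat_l; [exact HN | apply tail_incr; lra].
Qed.

Lemma sup_bound_ge0 x : 0 <= x < 1 -> 0 <= sup_bound b N x.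
Proof.
  intros H. apply sum_n_ge0. intros k _. apply Rplus_le_le_0_compat.
  - destruct k; [simpl; lra|]. apply pow_le; lra.
  - apply Rmult_le_pos; [exact HN | apply tail_ge0; lra].
Qed.

(** For b = 0 and N = 0 the bound is identically 0. *)
Lemma lip_bound_strict x y :
  (0 < b)%nat \/ 0 < N -> 0 <= x < y -> y < 1 -> lip_bound b N x < lip_bound b N y.
Proof.
  intros Hs H Hy.
  assert (Hle : forall k, (k <= b)%nat ->
    lip_lead k x + N * dtail (S k) x <= lip_lead k y + N * dtail (S k) y).
  { intros k _. apply Rplus_le_compat.
    - apply lip_lead_incr; lra.
    - apply Rmult_le_compat_l; [exact HN | apply dtail_incr; lra]. }
  destruct Hs as [Hb | Hn].
  - apply sum_n_lt_loc with 1%nat; [exact Hle | lia |].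
    apply Rplus_lt_le_compat; [simpl; lra |].
    apply Rmult_le_compat_l; [exact HN | apply dtail_incr; lra].
  - apply sum_n_lt_loc with 0%nat; [exact Hle | lia |].
    simpl lip_lead. apply Rplus_le_lt_compat; [lra |].
    apply Rmult_lt_compat_l; [exact Hn | apply dtail_1_lt; lra].
Qed.

Lemma lip_bound_0 : lip_bound b N 0 = 0.
Proof.
  unfold lip_bound. induction b as [|b' IH].
  - rewrite sum_O. unfold lip_lead, dtail. simpl. field.
  - rewrite sum_n_SR, IH. unfold lip_lead, dtail. simpl. field.
Qed.

(** Every monomial x^m in [sup_bound] has degree m >= 2 and appears as m x^(m-1)
    in [lip_bound].  At a root of the radius equation this gives
    sup_bound r <= r / 2, hence a positive schlicht radius. *)
Lemma sup_bound_le_lip x : 0 <= x < 1 -> 2 * sup_bound b N x <= x * lip_bound b N x.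
Proof.
  intros H. unfold sup_bound, lip_bound. induction b as [|b' IH].
  - rewrite !sum_O. simpl sup_lead. simpl lip_lead.
    assert (Ht := dtail_tail 1 x H). simpl INR in Ht. nra.
  - rewrite !sum_n_SR.
    assert (Ht := dtail_tail (S (S b')) x H).
    assert (H0 : 0 <= tail (S (S (S b'))) x) by (apply tail_ge0; lra).
    assert (Hi : 2 <= INR (S (S (S b')))).
    { rewrite !S_INR. assert (0 <= INR b') by apply pos_INR. lra. }
    assert (Hi' : 2 <= INR (S (S b'))).
    { rewrite !S_INR. assert (0 <= INR b') by apply pos_INR. lra. }
    assert (Hp : 0 <= x ^ S (S b')) by (apply pow_le; lra).
    assert (H1 : 2 * sup_lead (S b') x <= x * lip_lead (S b') x).
    { unfold sup_lead, lip_lead.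
      replace (x * (INR (S (S b')) * x ^ S b')) with (INR (S (S b')) * x ^ S (S b')) by (simpl; ring).
      apply Rmult_le_compat_r; assumption. }
    assert (H2 : 2 * tail (S (S (S b'))) x <= x * dtail (S (S b')) x) by nra.
    assert (H3 : N * (2 * tail (S (S (S b'))) x) <= N * (x * dtail (S (S b')) x))
      by (apply Rmult_le_compat_l; assumption).
    nra.
Qed.

Lemma lip_bound_continuous x : 0 <= x < 1 -> continuity_pt (lip_bound b N) x.
Proof.
  intros H. apply continuity_pt_filterlim.
  change (continuous (lip_bound b N) x).
  assert (Hc : forall k, continuous (fun t => lip_lead k t + N * dtail (S k) t) x).
  { intros k. apply (@ex_derive_continuous R_AbsRing R_NormedModule).
    unfold dtail. destruct k; simpl lip_lead; auto_derive; repeat split; try lra; nra. }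
  unfold lip_bound. induction b as [|b' IH].
  - apply continuous_ext with (2 := Hc 0%nat). intros t. now rewrite sum_O.
  - apply continuous_ext with (fun t => plus (sum_n (fun k => lip_lead k t + N * dtail (S k) t) b')
      (lip_lead (S b') t + N * dtail (S (S b')) t)).
    + intros t. now rewrite sum_Sn.
    + apply (continuous_plus (V := R_NormedModule)); [exact IH | apply Hc].
Qed.

(** If b > 0 the monomial 2 x alone reaches 1 at x = 1/2; if N > 0 the row k = 0
    has at least the value 2 N x / (1 - x). *)
Lemma lip_bound_large : (0 < b)%nat \/ 0 < N -> exists x, 0 < x < 1 /\ 1 <= lip_bound b N x.
Proof.
  intros Hs.
  assert (Hge : forall x k, 0 <= x < 1 -> (k <= b)%nat -> 0 <= lip_lead k x + N * dtail (S k) x).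
  { intros x k H _. apply Rplus_le_le_0_compat.
    - destruct k; [simpl; lra|]. apply Rmult_le_pos; [apply pos_INR | apply pow_le; lra].
    - apply Rmult_le_pos; [exact HN | apply dtail_ge0; lra]. }
  destruct Hs as [Hb | Hn].
  - exists (1 / 2). split; [lra|].
    assert (H := sum_n_ge_term (fun k => lip_lead k (1/2) + N * dtail (S k) (1/2)) b 1
      (fun k => Hge (1/2) k ltac:(lra)) Hb).
    cbv beta in H. fold (lip_bound b N (1/2)) in H.
    assert (0 <= N * dtail 2 (1/2)) by (apply Rmult_le_pos; [exact HN | apply dtail_ge0; lra]).
    replace (lip_lead 1 (1/2)) with 1 in H by (simpl; lra). lra.
  (* x solves 2 N x / (1 - x) = 1 *)
  - set (x := / (1 + 2 * N)).
    assert (Hx : 0 < x < 1).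
    { split; [apply Rinv_0_lt_compat; lra|].
      rewrite <- Rinv_1. apply Rinv_lt_contravar; lra. }
    exists x. split; [exact Hx|].
    assert (H := sum_n_ge_term (fun k => lip_lead k x + N * dtail (S k) x) b 0
      (fun k => Hge x k ltac:(lra)) ltac:(lia)).
    cbv beta in H. fold (lip_bound b N x) in H. simpl lip_lead in H.
    assert (H2 : N * (2 * x / (1 - x)) <= N * dtail 1 x)
      by (apply Rmult_le_compat_l; [exact HN | apply dtail_1_ge; lra]).
    assert (E : N * (2 * x / (1 - x)) = 1).
    { assert (Hx1 : 1 - x = 2 * N * x) by (unfold x; field; lra).
      rewrite Hx1. field. lra. }
    lra.
Qed.

Lemma lip_bound_root :
  (0 < b)%nat \/ 0 < N -> exists r, 0 < r < 1 /\ lip_bound b N r = 1.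
Proof.
  intros Hs. destruct (lip_bound_large Hs) as (x & Hx & [Hlt | Heq]).
  2: { exists x; auto. }
  destruct (IVT_interv (fun t => lip_bound b N t - 1) 0 x) as (r & Hr & Er).
  - intros t Ht. apply continuity_pt_minus; [apply lip_bound_continuous; lra|].
    apply continuity_pt_const. intros ? ?; reflexivity.
  - lra.
  - rewrite lip_bound_0; lra.
  - lra.
  - exists r. assert (r <> 0).
    { intros ->. rewrite lip_bound_0 in Er. lra. }
    lra.
Qed.
End Bounds.

(** M > 1 means b > 0 or N > 0; the root in (0,1) is then unique by strict
    monotonicity, and roots beyond 1 cannot be smaller. *)
Lemma radius_root_exists b M : sqrt (INR (S b)) <= M -> 1 < M ->
  exists r1, least_positive_root (radius_fun (S b) M) r1 /\ r1 < 1.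
Proof.
  intros HM H1. set (N := sqrt (M ^ 2 - INR (S b))).
  assert (HN : 0 <= N) by apply sqrt_pos.
  assert (Hs : (0 < b)%nat \/ 0 < N).
  { destruct b as [|b']; [right | left; lia].
    apply sqrt_lt_R0. simpl. nra. }
  destruct (lip_bound_root b N HN Hs) as (r & Hr & Er).
  exists r. split; [|lra]. split; [lra|]. split.
  - rewrite radius_fun_lip by lra. fold N. lra.
  - intros s Hs0 Es. destruct (Rle_lt_dec r s) as [|Hlt]; [assumption|].
    rewrite radius_fun_lip in Es by lra. fold N in Es.
    assert (lip_bound b N s < lip_bound b N r) by (apply lip_bound_strict; auto; lra). lra.
Qed.

(** For M > 1 there is a root below 1.  For M = 1 one has b = 0 and N = 0, and the
    radius function has no zero: it is 1 off r = 1, and 2 at r = 1 by the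
    convention for division by 0. *)
Lemma least_root_lt_1 b M r : sqrt (INR (S b)) <= M ->
  least_positive_root (radius_fun (S b) M) r -> r < 1.
Proof.
  intros HM (Hr0 & Er & Hmin).
  assert (Hb1 : 1 <= sqrt (INR (S b))).
  { rewrite <- sqrt_1 at 1. apply sqrt_le_1_alt. rewrite S_INR.
    assert (0 <= INR b) by apply pos_INR. lra. }
  destruct (Rle_lt_dec M 1) as [HM1 | HM1].
  - exfalso.
    assert (Hb : b = 0%nat).
    { destruct b as [|b']; [reflexivity|exfalso].
      assert (1 < sqrt (INR (S (S b')))); [|lra].
      rewrite <- sqrt_1 at 1. apply sqrt_lt_1_alt. rewrite !S_INR.
      assert (0 <= INR b') by apply pos_INR. lra. }
    subst b. assert (M = 1) by lra. subst M.
    unfold radius_fun in Er. simpl INR in Er.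
    replace (1 ^ 2 - 1) with 0 in Er by ring. rewrite sqrt_0 in Er.
    destruct (Req_dec r 1) as [-> | Hne].
    + replace (1 - (1 + 1) * 1 ^ 1 + 1 * 1 ^ (1 + 1)) with 0 in Er by (simpl; ring).
      unfold Rdiv in Er. lra.
    + assert (2 - (1 - (1 + 1) * r ^ 1 + 1 * r ^ (1 + 1)) / (1 - r) ^ 2
        - r * 0 / (1 - r) ^ 3 * (2 + r ^ 1 * (1 * r - (1 + 2))) = 1) by (simpl; field; lra).
      simpl in *. lra.
  - destruct (radius_root_exists b M HM HM1) as (r' & (Hr' & Er' & _) & Hr'1).
    specialize (Hmin r' Hr' Er'). lra.
Qed.

(** Weak monotonicity bounds the value by 1; the value 1 itself would be a
    smaller root. *)
Lemma lip_bound_lt_1 b M r x : sqrt (INR (S b)) <= M ->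
  least_positive_root (radius_fun (S b) M) r -> 0 <= x < r ->
  lip_bound b (sqrt (M ^ 2 - INR (S b))) x < 1.
Proof.
  intros HM Hl Hx. assert (Hr1 := least_root_lt_1 b M r HM Hl).
  destruct Hl as (Hr0 & Er & Hmin).
  rewrite radius_fun_lip in Er by lra.
  set (N := sqrt (M ^ 2 - INR (S b))) in *.
  assert (HN : 0 <= N) by apply sqrt_pos.
  destruct (Req_dec x 0) as [-> | Hne]; [rewrite lip_bound_0 by assumption; lra|].
  assert (Hle : lip_bound b N x <= lip_bound b N r) by (apply lip_bound_incr; auto; lra).
  assert (lip_bound b N x <> 1); [|lra].
  intros E. assert (r <= x); [|lra]. apply Hmin; [lra|].
  rewrite radius_fun_lip by lra. fold N. lra.
Qed.

(** * Convergence and fixed points in the complex plane *)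

Definition Ccv (u : nat -> C) (l : C) : Prop :=
  forall eps, 0 < eps -> exists n0, forall n, (n0 <= n)%nat -> Cmod (u n - l) < eps.

Lemma filterlim_Ccv (u : nat -> C) (l : C) :
  filterlim u eventually (locally l) -> Ccv u l.
Proof.
  intros H eps Heps.
  apply (proj1 (filterlim_locally_ball_norm (K := C_AbsRing) (U := C_NormedModule) u l)
    ) with (eps := mkposreal eps Heps) in H.
  exact H.
Qed.

Lemma Cmod_sub_sym (z w : C) : Cmod (z - w) = Cmod (w - z).
Proof. rewrite <- Cmod_opp. f_equal. ring. Qed.

Lemma Cmod_sub_0 (z w : C) : Cmod (z - w) = 0 -> z = w.
Proof.
  intros H. apply Cmod_eq_0 in H. replace z with (z - w + w)%C by ring. rewrite H. ring.
Qed.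

Lemma Cmod_sub_tri (x y z : C) : Cmod (x - z) <= Cmod (x - y) + Cmod (y - z).
Proof. replace (x - z)%C with ((x - y) + (y - z))%C by ring. apply Cmod_triangle. Qed.

Lemma Cmod_sub_le (x y : C) : Cmod x <= Cmod (x - y) + Cmod y.
Proof. replace x with ((x - y) + y)%C at 1 by ring. apply Cmod_triangle. Qed.

Lemma Ccv_bound (u : nat -> C) (l : C) B :
  Ccv u l -> (forall n, Cmod (u n) <= B) -> Cmod l <= B.
Proof.
  intros Hu HB. apply Rnot_lt_le. intros Hlt.
  destruct (Hu (Cmod l - B)) as [n0 Hn]; [lra|].
  specialize (Hn n0 (le_n _)). specialize (HB n0).
  assert (H := Cmod_sub_le l (u n0)). rewrite Cmod_sub_sym in H. lra.
Qed.

(** The iterates of T from 0 are the partial sums of a series that is dominated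
    by a geometric one. *)
Lemma banach_disk (T : C -> C) (rho l : R) : 0 <= rho -> 0 <= l < 1 ->
  (forall z, Cmod z <= rho -> Cmod (T z) <= rho) ->
  (forall z w, Cmod z <= rho -> Cmod w <= rho -> Cmod (T z - T w) <= l * Cmod (z - w)) ->
  exists z, Cmod z <= rho /\ T z = z.
Proof.
  intros Hrho Hl Hself Hlip.
  set (u := fun n => Nat.iter n T (RtoC 0)).
  assert (Hu : forall n, Cmod (u n) <= rho).
  { induction n as [|n IH]; [simpl; rewrite Cmod_0; exact Hrho | apply Hself, IH]. }
  assert (Hd : forall n, Cmod (u (S n) - u n) <= Cmod (u 1%nat - u 0%nat) * l ^ n).
  { induction n as [|n IH]; [simpl pow; lra|].
    apply Rle_trans with (l * Cmod (u (S n) - u n)); [apply (Hlip (u (S n)) (u n)); apply Hu|].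
    simpl pow. nra. }
  assert (Hex : ex_series (K := C_AbsRing) (V := C_NormedModule) (fun n => u (S n) - u n)%C).
  { apply (ex_series_le (K := C_AbsRing) (V := C_CompleteNormedModule)) with
      (b := fun n => Cmod (u 1%nat - u 0%nat) * l ^ n).
    - exact Hd.
    - apply (ex_series_scal_l (K := R_AbsRing) (V := R_NormedModule) (Cmod (u 1%nat - u 0%nat)) (fun n => l ^ n)). exists (/ (1 - l)).
      apply is_series_geom. rewrite Rabs_pos_eq; lra. }
  destruct Hex as [z Hz]. apply filterlim_Ccv in Hz.
  assert (Hs : forall n, sum_n (fun n => u (S n) - u n)%C n = u (S n)).
  { induction n as [|n IH].
    - rewrite sum_O. simpl. ring.
    - rewrite sum_Sn, IH. change (u (S n) + (u (S (S n)) - u (S n)) = u (S (S n)))%C. ring. }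
  assert (Hzr : Cmod z <= rho).
  { apply Ccv_bound with (1 := Hz). intros n.
    change (Cmod (sum_n (fun n => u (S n) - u n)%C n) <= rho). rewrite Hs. apply Hu. }
  exists z. split; [exact Hzr|].
  apply Cmod_sub_0. apply Rle_antisym; [|apply Cmod_ge_0].
  apply le_epsilon. intros eps Heps.
  destruct (Hz (eps / 2)) as [n0 Hn]; [lra|].
  assert (H1 := Hn n0 (le_n _)). assert (H2 := Hn (S n0) (le_S _ _ (le_n _))).
  change (Cmod (sum_n (fun n => u (S n) - u n)%C n0 - z) < eps / 2) in H1.
  change (Cmod (sum_n (fun n => u (S n) - u n)%C (S n0) - z) < eps / 2) in H2.
  rewrite Hs in H1, H2.
  assert (H3 := Hlip z (u (S n0)) Hzr (Hu _)).
  assert (H4 := Cmod_sub_tri (T z) (T (u (S n0))) z).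
  change (T (u (S n0))) with (u (S (S n0))) in *.
  rewrite (Cmod_sub_sym z) in H3.
  assert (0 <= Cmod (u (S n0) - z)) by apply Cmod_ge_0. nra.
Qed.

(** The topology of the plane is the product one, given by squares; round disks
    define the same neighbourhoods. *)
Lemma locally_Cmod (z : C) (P : C -> Prop) :
  locally z P <-> exists d, 0 < d /\ forall w, Cmod (w - z) < d -> P w.
Proof.
  split.
  - intros H. apply (locally_norm_le_locally (K := C_AbsRing) (V := C_NormedModule) z P) in H.
    destruct H as [d Hd]. exists d. split; [apply cond_pos | exact Hd].
  - intros (d & Hd & H). apply (locally_le_locally_norm (K := C_AbsRing) (V := C_NormedModule) z P).
    exists (mkposreal d Hd). exact H.
Qed.

(** * Inverting a contractive perturbation of the identity *)

(** A continuous image of a disk is connected: if V and W separated it, the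
    image of a segment joining a point over W to a point over V would give a
    continuous function with values 1 and -1 only. *)
Lemma connected_image_of_disk (phi : C -> C) (s : R) (U : C -> Prop) :
  (forall w, Cmod w < s -> U (phi w)) ->
  (forall z, U z -> exists w, Cmod w < s /\ phi w = z) ->
  (forall w, Cmod w < s -> forall e, 0 < e -> exists d, 0 < d /\
     forall w', Cmod w' < s -> Cmod (w' - w) < d -> Cmod (phi w' - phi w) < e) ->
  connected_open U.
Proof.
  intros HU Hsurj Hcont V W HV HW Hcov Hdisj.
  destruct (classic (forall z, U z -> V z)) as [|Hno]; [left; assumption | right].
  apply not_all_ex_not in Hno. destruct Hno as [z0 Hz0].
  apply imply_to_and in Hz0. destruct Hz0 as [Uz0 nVz0].
  intros z1 Uz1. apply NNPP. intros nWz1.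
  destruct (Hsurj z0 Uz0) as (w0 & Hw0 & E0). destruct (Hsurj z1 Uz1) as (w1 & Hw1 & E1).
  set (g := fun t : R => (w0 + RtoC t * (w1 - w0))%C).
  assert (Hg : forall t, 0 <= t <= 1 -> Cmod (g t) < s).
  { intros t Ht. unfold g.
    replace (w0 + RtoC t * (w1 - w0))%C with (RtoC (1 - t) * w0 + RtoC t * w1)%C
      by (rewrite RtoC_minus; ring).
    eapply Rle_lt_trans; [apply Cmod_triangle|].
    rewrite !Cmod_mult, !Cmod_R, !Rabs_pos_eq by lra.
    destruct (Req_dec t 0) as [->|Hne]; [lra|]. 
    assert (t * Cmod w1 < t * s) by (apply Rmult_lt_compat_l; lra).
    assert ((1 - t) * Cmod w0 <= (1 - t) * s) by (apply Rmult_le_compat_l; lra). lra. }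
  assert (Hgd : forall t t', Cmod (g t' - g t) = Rabs (t' - t) * Cmod (w1 - w0)).
  { intros t t'. unfold g.
    replace (w0 + RtoC t' * (w1 - w0) - (w0 + RtoC t * (w1 - w0)))%C
      with (RtoC (t' - t) * (w1 - w0))%C by (rewrite RtoC_minus; ring).
    now rewrite Cmod_mult, Cmod_R. }
  assert (HD : 0 < Cmod (w1 - w0) + 1) by (assert (H := Cmod_ge_0 (w1 - w0)); lra).
  assert (Hopen : forall (X : C -> Prop) t, open X -> 0 <= t <= 1 -> X (phi (g t)) ->
    exists d, 0 < d /\ forall t', Rabs (t' - t) < d -> Cmod (g t') < s /\ X (phi (g t'))).
  { intros X t HX Ht HXt. apply HX in HXt. apply locally_Cmod in HXt.
    destruct HXt as (e & He & HXe).
    destruct (Hcont (g t) (Hg t Ht) e He) as (d & Hd & Hphi).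
    assert (Hst := Hg t Ht).
    exists (Rmin d (s - Cmod (g t)) / (Cmod (w1 - w0) + 1)).
    assert (Hm : 0 < Rmin d (s - Cmod (g t))) by (apply Rmin_glb_lt; lra).
    split; [apply Rdiv_lt_0_compat; assumption|].
    intros t' Ht'.
    assert (Hdist : Cmod (g t' - g t) < Rmin d (s - Cmod (g t))).
    { rewrite Hgd. apply Rle_lt_trans with (Rabs (t' - t) * (Cmod (w1 - w0) + 1)).
      - apply Rmult_le_compat_l; [apply Rabs_pos | lra].
      - apply Rmult_lt_compat_r with (r := Cmod (w1 - w0) + 1) in Ht'; [|exact HD].
        replace (Rmin d (s - Cmod (g t)) / (Cmod (w1 - w0) + 1) * (Cmod (w1 - w0) + 1))
          with (Rmin d (s - Cmod (g t))) in Ht' by (field; lra). exact Ht'. }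
    assert (H1 := Rmin_l d (s - Cmod (g t))). assert (H2 := Rmin_r d (s - Cmod (g t))).
    assert (Hin : Cmod (g t') < s) by (assert (H := Cmod_sub_le (g t') (g t)); lra).
    split; [exact Hin|]. apply HXe. apply Hphi; [exact Hin | lra]. }
  set (f := fun t : R => if excluded_middle_informative (Cmod (g t) < s /\ V (phi (g t)))
                         then 1 else - 1).
  assert (Hloc : forall t, 0 <= t <= 1 -> exists d, 0 < d /\
     forall t', Rabs (t' - t) < d -> f t' = f t).
  { intros t Ht. destruct (Hcov _ (HU _ (Hg t Ht))) as [Vt | Wt].
    - destruct (Hopen V t HV Ht Vt) as (d & Hd & H). exists d. split; [exact Hd|].
      intros t' Ht'. destruct (H t' Ht') as [Hs Vt']. unfold f.
      destruct excluded_middle_informative as [_|n1]; [|tauto].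
      destruct excluded_middle_informative as [_|n2]; [reflexivity|].
      exfalso. apply n2. split; [apply Hg, Ht | exact Vt].
    - destruct (Hopen W t HW Ht Wt) as (d & Hd & H). exists d. split; [exact Hd|].
      intros t' Ht'. destruct (H t' Ht') as [Hs Wt']. unfold f.
      destruct excluded_middle_informative as [[_ Vt']|_].
      { exfalso. apply (Hdisj (phi (g t')) (HU _ Hs)). split; assumption. }
      destruct excluded_middle_informative as [[_ Vt]|_]; [|reflexivity].
      exfalso. apply (Hdisj (phi (g t)) (HU _ (Hg t Ht))). split; assumption. }
  assert (Hval : forall t, f t = 1 \/ f t = - 1).
  { intros t. unfold f. destruct excluded_middle_informative; auto. }
  assert (Ef0 : f 0 = - 1).
  { unfold f. destruct excluded_middle_informative as [[_ HV0]|]; [exfalso | reflexivity].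
    apply nVz0. rewrite <- E0. replace w0 with (g 0) by (unfold g; ring). exact HV0. }
  assert (Eg1 : g 1 = w1) by (unfold g; ring).
  assert (Ef1 : f 1 = 1).
  { unfold f. destruct excluded_middle_informative as [_|n]; [reflexivity | exfalso].
    apply n. rewrite Eg1. split; [exact Hw1|]. rewrite E1.
    destruct (Hcov z1 Uz1); [assumption | contradiction]. }
  destruct (IVT_interv f 0 1) as (t & Ht & Et); try lra.
  - intros t Ht. destruct (Hloc t Ht) as (d & Hd & H).
    intros e He. exists d. split; [exact Hd|]. intros t' [_ Ht'].
    simpl in *. unfold R_dist in *. rewrite (H t' Ht'). 
    replace (f t - f t) with 0 by ring. now rewrite Rabs_R0.
  - destruct (Hval t); lra.
Qed.

(** F - id is [lip rho]-Lipschitz and bounded by [sup rho] on each closed disk of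
    radius rho < r.  The constants may tend to 1 as rho tends to r, so
    estimates are made on these smaller disks. *)
Section InverseFunction.
Variables (F : C -> C) (r s : R) (lip sup : R -> R).
Hypothesis Hlip01 : forall rho, 0 <= rho < r -> 0 <= lip rho < 1.
Hypothesis Hlip : forall rho z w, 0 <= rho < r -> Cmod z <= rho -> Cmod w <= rho ->
  Cmod ((F z - z) - (F w - w)) <= lip rho * Cmod (z - w).
Hypothesis Hsup : forall rho z, 0 <= rho < r -> Cmod z <= rho -> Cmod (F z - z) <= sup rho.
Hypothesis Hs : 0 < s <= r.
Hypothesis Hsup_s : forall rho, 0 <= rho < r -> sup rho <= r - s.

Lemma perturbed_id_lower rho z w : 0 <= rho < r -> Cmod z <= rho -> Cmod w <= rho ->
  (1 - lip rho) * Cmod (z - w) <= Cmod (F z - F w).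
Proof.
  intros Hr Hz Hw. assert (H := Hlip rho z w Hr Hz Hw).
  assert (H1 : Cmod (z - w) <= Cmod (F z - F w) + Cmod ((F z - z) - (F w - w))).
  { replace (z - w)%C with ((F z - F w) + - ((F z - z) - (F w - w)))%C at 1 by ring.
    eapply Rle_trans; [apply Cmod_triangle|]. rewrite Cmod_opp. lra. }
  lra.
Qed.

Lemma perturbed_id_upper rho z w : 0 <= rho < r -> Cmod z <= rho -> Cmod w <= rho ->
  Cmod (F z - F w) <= 2 * Cmod (z - w).
Proof.
  intros Hr Hz Hw. assert (H := Hlip rho z w Hr Hz Hw). assert (H0 := Hlip01 rho Hr).
  replace (F z - F w)%C with ((F z - z - (F w - w)) + (z - w))%C by ring.
  eapply Rle_trans; [apply Cmod_triangle|].
  assert (0 <= Cmod (z - w)) by apply Cmod_ge_0. nra.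
Qed.

Lemma perturbed_id_univalent : univalent_on (disk r) F.
Proof.
  intros z w Hz Hw E. unfold disk in *.
  set (rho := Rmax (Cmod z) (Cmod w)).
  assert (Hr : 0 <= rho < r).
  { split; [apply Rle_trans with (Cmod z); [apply Cmod_ge_0 | apply Rmax_l] |].
    apply Rmax_lub_lt; assumption. }
  assert (H := perturbed_id_lower rho z w Hr (Rmax_l _ _) (Rmax_r _ _)).
  rewrite E in H. replace (F w - F w)%C with (RtoC 0) in H by ring. rewrite Cmod_0 in H.
  assert (H0 := Hlip01 rho Hr). assert (H1 := Cmod_ge_0 (z - w)).
  apply Cmod_sub_0. nra.
Qed.

(** The bound on z is below r by the amount s - |w|, locally uniformly in w;
    this is what makes the inverse continuous. *)
Lemma perturbed_id_solve w : Cmod w < s ->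
  exists z, Cmod z <= r - s + Cmod w /\ F z = w.
Proof.
  intros Hw. set (rho := r - s + Cmod w).
  assert (Hw0 := Cmod_ge_0 w).
  assert (Hr : 0 <= rho < r) by (unfold rho; lra).
  destruct (banach_disk (fun z => w - (F z - z))%C rho (lip rho)) as (z & Hz & E).
  - lra.
  - apply Hlip01, Hr.
  - intros z Hz. unfold Cminus at 1. eapply Rle_trans; [apply Cmod_triangle|].
    rewrite Cmod_opp. assert (H := Hsup rho z Hr Hz). assert (H1 := Hsup_s rho Hr). unfold rho. lra.
  - intros z z' Hz Hz'.
    replace (w - (F z - z) - (w - (F z' - z')))%C with (- ((F z - z) - (F z' - z')))%C by ring.
    rewrite Cmod_opp. apply Hlip; assumption.
  - exists z. split; [exact Hz|].
    replace (F z) with (w + z - (w - (F z - z)))%C by ring. rewrite E. ring.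
Qed.

Lemma perturbed_id_schlicht : image_contains_schlicht_disk F (disk r) s.
Proof.
  split; [lra|].
  exists (fun z => disk r z /\ disk s (F z)). unfold disk.
  set (phi := fun w => epsilon (inhabits (RtoC 0))
     (fun z => Cmod z <= r - s + Cmod w /\ F z = w)).
  assert (Hphi : forall w, Cmod w < s -> Cmod (phi w) <= r - s + Cmod w /\ F (phi w) = w).
  { intros w Hw. unfold phi. apply epsilon_spec. apply perturbed_id_solve, Hw. }
  assert (H0s : Cmod 0 < s) by (rewrite Cmod_0; lra).
  split; [split; [|split]|split; [|split]].
  - exists (phi 0). destruct (Hphi 0 H0s) as [H1 H2].
    rewrite H2, Cmod_0 in *. lra.
  - intros z [Hz HFz]. apply locally_Cmod.
    set (rho := (Cmod z + r) / 2).
    assert (Hz0 := Cmod_ge_0 z).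
    assert (Hr : 0 <= rho < r) by (unfold rho; lra).
    exists (Rmin (rho - Cmod z) ((s - Cmod (F z)) / 2)). split.
    { apply Rmin_glb_lt; unfold rho; lra. }
    intros w Hw.
    assert (H1 := Rmin_l (rho - Cmod z) ((s - Cmod (F z)) / 2)).
    assert (H2 := Rmin_r (rho - Cmod z) ((s - Cmod (F z)) / 2)).
    assert (H3 := Cmod_sub_le w z).
    split; [lra|].
    assert (H4 := perturbed_id_upper rho w z Hr ltac:(lra) ltac:(unfold rho; lra)).
    assert (H5 := Cmod_sub_le (F w) (F z)). lra.
  - apply connected_image_of_disk with phi s.
    + intros w Hw. destruct (Hphi w Hw) as [H1 H2]. rewrite H2. lra.
    + intros z [Hz HFz]. exists (F z). split; [exact HFz|].
      destruct (Hphi (F z) HFz) as [H1 H2].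
      apply perturbed_id_univalent; unfold disk; [lra | exact Hz | exact H2].
    + intros w Hw e He.
      (* all w' with |w'| < t have their preimages in the disk of radius rho < r *)
      set (t := (Cmod w + s) / 2). set (rho := r - s + t).
      assert (Hw0 := Cmod_ge_0 w).
      assert (Hr : 0 <= rho < r) by (unfold rho, t; lra).
      assert (Hl := Hlip01 rho Hr).
      exists (Rmin (t - Cmod w) ((1 - lip rho) * e)). split.
      { apply Rmin_glb_lt; [unfold t; lra | apply Rmult_lt_0_compat; lra]. }
      intros w' Hw' Hd.
      assert (H1 := Rmin_l (t - Cmod w) ((1 - lip rho) * e)).
      assert (H2 := Rmin_r (t - Cmod w) ((1 - lip rho) * e)).
      assert (H3 := Cmod_sub_le w' w).
      destruct (Hphi w Hw) as [H4 H5]. destruct (Hphi w' Hw') as [H6 H7].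
      assert (H8 := perturbed_id_lower rho (phi w') (phi w) Hr
        ltac:(unfold rho; lra) ltac:(unfold rho, t; lra)).
      rewrite H5, H7 in H8.
      apply Rmult_lt_reg_l with (1 - lip rho); lra.
  - intros z [Hz _]. exact Hz.
  - intros z w [Hz _] [Hw _]. apply perturbed_id_univalent; assumption.
  - intros w. split.
    + intros Hw. destruct (Hphi w Hw) as [H1 H2]. exists (phi w). rewrite H2.
      split; [split; lra | reflexivity].
    + intros (z & [_ Hz] & <-). exact Hz.
Qed.
End InverseFunction.

(** * Finite sums of complex numbers *)

Lemma sum_n_SC (f : nat -> C) n : sum_n f (S n) = (sum_n f n + f (S n))%C.
Proof. exact (sum_Sn f n). Qed.

Lemma Cmod_sum_n_le (f : nat -> C) n : Cmod (sum_n f n) <= sum_n (fun k => Cmod (f k)) n.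
Proof.
  induction n as [|n IH]; [rewrite !sum_O; lra|].
  rewrite sum_n_SC, sum_n_SR. eapply Rle_trans; [apply Cmod_triangle | lra].
Qed.

Lemma sum_n_Cmult_l (c : C) (f : nat -> C) n :
  (c * sum_n f n)%C = sum_n (fun k => c * f k)%C n.
Proof. symmetry. exact (sum_n_mult_l (K := C_Ring) c f n). Qed.

Lemma sum_n_minusC (f g : nat -> C) n :
  (sum_n f n - sum_n g n)%C = sum_n (fun k => f k - g k)%C n.
Proof.
  induction n as [|n IH]; [now rewrite !sum_O|].
  rewrite !sum_n_SC, <- IH. ring.
Qed.

Lemma Re_sum_n (f : nat -> C) n : Re (sum_n f n) = sum_n (fun k => Re (f k)) n.
Proof.
  induction n as [|n IH]; [now rewrite !sum_O|].
  rewrite sum_n_SC, sum_n_SR, <- IH. reflexivity.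
Qed.

Lemma Re_mult_conj (z : C) : Re (z * Cconj z)%C = Cmod z ^ 2.
Proof. now rewrite <- Cmod2_conj. Qed.

(** * Roots of unity and a Parseval inequality *)

Definition cis (t : R) : C := (cos t, sin t).

Lemma cis_add s t : cis (s + t) = (cis s * cis t)%C.
Proof.
  unfold cis, Cmult; simpl. rewrite cos_plus, sin_plus. f_equal; ring.
Qed.

Lemma cis_0 : cis 0 = RtoC 1.
Proof. unfold cis. now rewrite cos_0, sin_0. Qed.

Lemma cis_conj t : Cconj (cis t) = cis (- t).
Proof. unfold cis, Cconj; simpl. now rewrite cos_neg, sin_neg. Qed.

Lemma cis_pow t n : (cis t ^ n)%C = cis (INR n * t).
Proof.
  induction n as [|n IH].
  - simpl. now rewrite Rmult_0_l, cis_0.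
  - rewrite Cpow_S, IH, <- cis_add, S_INR. f_equal. ring.
Qed.

Lemma cis_mod t : Cmod (cis t) = 1.
Proof.
  assert (H := sin2_cos2 t). unfold Rsqr in H.
  unfold cis, Cmod; simpl.
  replace (_ + _) with 1 by lra. apply sqrt_1.
Qed.

Lemma cis_neq_1 t : 0 < t < 2 * PI -> cis t <> RtoC 1.
Proof.
  intros Ht H. apply (f_equal Re) in H. simpl in H.
  replace t with (2 * (t / 2)) in H by field. rewrite cos_2a_sin in H.
  assert (0 < sin (t / 2)) by (apply sin_gt_0; lra). nra.
Qed.

Lemma geom_sum_C (w : C) n : ((w - 1) * sum_n (fun j => w ^ j) n)%C = (w ^ S n - 1)%C.
Proof.
  induction n as [|n IH].
  - rewrite sum_O. simpl. ring.
  - rewrite sum_n_SC, Cmult_plus_distr_l, IH. rewrite !Cpow_S. ring.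
Qed.

(** The argument of the j-th root of unity of order m + 1. *)
Definition angle (m j : nat) : R := 2 * PI * INR j / INR (S m).

Lemma sum_roots_0 (m e : nat) : (1 <= e <= m)%nat ->
  sum_n (fun j => cis (INR e * angle m j)) m = RtoC 0.
Proof.
  intros He. set (t := 2 * PI * INR e / INR (S m)).
  assert (Hm : 0 < INR (S m)) by (apply lt_0_INR; lia).
  assert (He1 : 0 < INR e) by (apply lt_0_INR; lia).
  assert (He2 : INR e < INR (S m)) by (apply lt_INR; lia).
  assert (Hpi := PI_RGT_0).
  assert (Ht : 0 < t < 2 * PI).
  { unfold t. split.
    - apply Rdiv_lt_0_compat; nra.
    - apply Rmult_lt_reg_r with (INR (S m)); [exact Hm|]. unfold Rdiv.
      rewrite Rmult_assoc, Rinv_l by lra. nra. }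
  rewrite sum_n_ext with (b := fun j => (cis t ^ j)%C).
  2: { intros j. rewrite cis_pow. f_equal. unfold angle, t. field. lra. }
  assert (H := geom_sum_C (cis t) m).
  rewrite cis_pow in H.
  replace (INR (S m) * t) with (0 + 2 * INR e * PI) in H by (unfold t; field; lra).
  replace (cis (0 + 2 * INR e * PI)) with (RtoC 1) in H.
  2: { unfold cis. rewrite cos_period, sin_period, cos_0, sin_0. reflexivity. }
  replace (RtoC 1 - RtoC 1)%C with (RtoC 0) in H by ring.
  apply (f_equal Cmod) in H. rewrite Cmod_mult, Cmod_0 in H.
  apply Rmult_integral in H. destruct H as [H | H].
  - exfalso. apply (cis_neq_1 t Ht). now apply Cmod_sub_0.
  - now apply Cmod_eq_0.
Qed.

(** The real inner product of two functions sampled at the roots of unity of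
    order m + 1. *)
Definition dot (m : nat) (p q : C -> C) : R :=
  sum_n (fun j => Re (p (cis (angle m j)) * Cconj (q (cis (angle m j))))%C) m.

Lemma dot_sym m p q : dot m p q = dot m q p.
Proof.
  apply sum_n_ext. intros j.
  generalize (p (cis (angle m j))) (q (cis (angle m j))). intros [x y] [x' y'].
  simpl. ring.
Qed.

Lemma dot_sum_l m (p : nat -> C -> C) q n :
  dot m (fun z => sum_n (fun i => p i z) n) q = sum_n (fun i => dot m (p i) q) n.
Proof.
  unfold dot. rewrite sum_n_switch. apply sum_n_ext. intros j.
  rewrite <- Re_sum_n. f_equal. rewrite Cmult_comm, sum_n_Cmult_l.
  apply sum_n_ext. intros i. apply Cmult_comm.
Qed.

Lemma dot_plus_l m p1 p2 q :
  dot m (fun z => p1 z + p2 z)%C q = dot m p1 q + dot m p2 q.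
Proof.
  unfold dot. rewrite <- (sum_n_plus (G := R_AbelianMonoid)). apply sum_n_ext. intros j.
  change plus with Rplus. rewrite <- re_plus. f_equal. ring.
Qed.

Lemma dot_ext m p p' q q' : (forall z, p z = p' z) -> (forall z, q z = q' z) ->
  dot m p q = dot m p' q'.
Proof. intros Hp Hq. apply sum_n_ext. intros j. now rewrite Hp, Hq. Qed.

Lemma dot_sum_sum m (p q : nat -> C -> C) n n' :
  dot m (fun z => sum_n (fun i => p i z) n) (fun z => sum_n (fun i => q i z) n')
  = sum_n (fun i => sum_n (fun i' => dot m (p i) (q i')) n') n.
Proof.
  rewrite dot_sum_l. apply sum_n_ext. intros i.
  rewrite dot_sym, dot_sum_l. apply sum_n_ext. intros i'. apply dot_sym.
Qed.

(** Pythagoras as an inequality: the cross terms are nonnegative when the vectors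
    form pairwise angles of at most a right angle. *)
Lemma dot_diag_le m (p : nat -> C -> C) n :
  (forall i j, (i <= n)%nat -> (j <= n)%nat -> i <> j -> 0 <= dot m (p i) (p j)) ->
  sum_n (fun i => dot m (p i) (p i)) n
  <= dot m (fun z => sum_n (fun i => p i z) n) (fun z => sum_n (fun i => p i z) n).
Proof.
  induction n as [|n IH]; intros H.
  - rewrite sum_O. apply Req_le, dot_ext; intros z; now rewrite sum_O.
  - rewrite sum_n_SR.
    set (q := fun z => sum_n (fun i => p i z) n) in *.
    rewrite (dot_ext m (fun z => sum_n (fun i => p i z) (S n)) (fun z => q z + p (S n) z)%C
      (fun z => sum_n (fun i => p i z) (S n)) (fun z => q z + p (S n) z)%C)
      by (intros z; apply sum_n_SC).
    rewrite dot_plus_l, (dot_sym m q), (dot_sym m (p (S n)) (fun z => _ + _)%C), !dot_plus_l.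
    rewrite (dot_sym m (p (S n)) q).
    assert (H1 : sum_n (fun i => dot m (p i) (p i)) n <= dot m q q)
      by (apply IH; intros; apply H; lia).
    assert (H2 : 0 <= dot m q (p (S n))).
    { unfold q. rewrite dot_sum_l. apply sum_n_ge0. intros k Hk. apply H; lia. }
    lra.
Qed.

Definition mono (c : C) (n k : nat) (z : C) : C := (c * (z ^ n * Cconj z ^ k))%C.

Lemma mono_cis_product c c' n k n' k' t :
  (mono c n k (cis t) * Cconj (mono c' n' k' (cis t)))%C
  = (c * Cconj c' * cis ((INR (n + k') - INR (n' + k)) * t))%C.
Proof.
  unfold mono. rewrite !Cmult_conj, !Cpow_conj, Cconj_conj, cis_conj, !cis_pow.
  replace ((INR (n + k') - INR (n' + k)) * t)
    with (INR n * t + INR k * - t + INR n' * - t + INR k' * t)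
    by (rewrite !plus_INR; ring).
  rewrite !cis_add. ring.
Qed.

Lemma dot_mono_eq m c c' n k n' k' : (n + k' = n' + k)%nat ->
  dot m (mono c n k) (mono c' n' k') = INR (S m) * Re (c * Cconj c')%C.
Proof.
  intros E. rewrite <- sum_n_const. apply sum_n_ext. intros j.
  rewrite mono_cis_product, E, Rminus_diag, Rmult_0_l, cis_0. f_equal. ring.
Qed.

(** Sampling at m + 1 points distinguishes frequencies that differ by at most m. *)
Lemma dot_mono_neq m c c' n k n' k' : (n + k' <> n' + k)%nat ->
  (n + k' <= m)%nat -> (n' + k <= m)%nat ->
  dot m (mono c n k) (mono c' n' k') = 0.
Proof.
  revert c c' n k n' k'.
  assert (Hlt : forall c c' n k n' k', (n' + k < n + k')%nat -> (n + k' <= m)%nat ->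
    dot m (mono c n k) (mono c' n' k') = 0).
  { intros c c' n k n' k' Hlt Hm. unfold dot.
    rewrite sum_n_ext with
      (b := fun j => Re (c * Cconj c' * cis (INR (n + k' - (n' + k)) * angle m j))%C).
    2: { intros j. rewrite mono_cis_product, minus_INR by lia. reflexivity. }
    rewrite <- Re_sum_n, <- sum_n_Cmult_l, sum_roots_0 by lia.
    rewrite Cmult_0_r. reflexivity. }
  intros c c' n k n' k' Hne H1 H2.
  destruct (Nat.lt_gt_cases (n + k') (n' + k)) as [[H | H] _]; [exact Hne | |].
  - rewrite dot_sym. apply Hlt; lia.
  - apply Hlt; lia.
Qed.

(** Within a row (fixed k) the monomials have distinct frequencies and are
    orthogonal; monomials of different rows are orthogonal or have a
    nonnegative inner product by the sign hypothesis.  So [dot_diag_le] applies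
    twice, to the rows and inside each row. *)
Lemma parseval_le (c : nat -> nat -> C) (K b : nat) (B : R) : 0 <= B ->
  (forall n n' k k', (k <= b)%nat -> (k' <= b)%nat -> (n <= K)%nat -> (n' <= K)%nat ->
     k <> k' -> n <> n' -> 0 <= Re (c n k * Cconj (c n' k'))%C) ->
  (forall z, Cmod z = 1 ->
     Cmod (sum_n (fun k => sum_n (fun n => mono (c n k) n k z) K) b) <= B) ->
  sum_n (fun k => sum_n (fun n => Cmod (c n k) ^ 2) K) b <= B ^ 2.
Proof.
  intros HB Hsign Hbd.
  set (m := (K + b)%nat).
  set (row := fun k z => sum_n (fun n => mono (c n k) n k z) K).
  assert (Hm : 0 < INR (S m)) by (apply lt_0_INR; lia).
  apply Rmult_le_reg_l with (INR (S m)); [exact Hm|].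
  apply Rle_trans with (dot m (fun z => sum_n (fun k => row k z) b)
                              (fun z => sum_n (fun k => row k z) b)).
  - eapply Rle_trans; [|apply dot_diag_le].
    + rewrite <- (sum_n_mult_l (K := R_Ring)). apply sum_n_le_loc. intros k Hk.
      eapply Rle_trans; [|apply (dot_diag_le m (fun n => mono (c n k) n k))].
      * rewrite <- (sum_n_mult_l (K := R_Ring)). apply sum_n_le_loc. intros n Hn.
        rewrite dot_mono_eq by lia. rewrite Re_mult_conj. apply Rle_refl.
      * intros n n' Hn Hn' Hne. rewrite dot_mono_neq; [lra | lia..].
    + intros k k' Hk Hk' Hne. unfold row. rewrite dot_sum_sum.
      apply sum_n_ge0. intros n Hn. apply sum_n_ge0. intros n' Hn'.
      destruct (Nat.eq_dec (n + k') (n' + k)) as [E | E].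
      * rewrite dot_mono_eq by exact E. apply Rmult_le_pos; [lra|].
        apply Hsign; auto. lia.
      * rewrite dot_mono_neq; [lra | lia..].
  - rewrite <- sum_n_const. apply sum_n_le_loc. intros j _.
    rewrite Re_mult_conj. apply pow_incr. split; [apply Cmod_ge_0|].
    apply Hbd, cis_mod.
Qed.

(** * The condition on the arguments *)

Lemma Arg_le_Re (z : C) : z <> RtoC 0 -> Rabs (Arg z) <= PI / 2 -> 0 <= Re z.
Proof.
  intros Hz H. assert (Hm := proj1 (Cmod_gt_0 z) Hz).
  assert (Hr : - 1 <= Re z / Cmod z <= 1).
  { apply Rabs_le_between. unfold Rdiv.
    rewrite Rabs_mult, Rabs_inv, (Rabs_pos_eq (Cmod z)) by lra.
    apply Rmult_le_reg_r with (Cmod z); [exact Hm|].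
    rewrite Rmult_assoc, Rinv_l by lra. assert (H1 := re_le_Cmod z). lra. }
  assert (Ha : 0 <= acos (Re z / Cmod z) <= PI / 2).
  { assert (Hb := acos_bound (Re z / Cmod z)). split; [lra|].
    unfold Arg in H. destruct Rle_dec; [|rewrite Rabs_Ropp in H];
      rewrite Rabs_pos_eq in H; lra. }
  assert (Hc : 0 <= cos (acos (Re z / Cmod z))) by (apply cos_ge_0; lra).
  rewrite cos_acos in Hc by exact Hr.
  replace (Re z) with (Re z / Cmod z * Cmod z) by (field; lra).
  apply Rmult_le_pos; lra.
Qed.

Lemma Arg_quotient_sign (x y : C) :
  (x <> RtoC 0 -> y <> RtoC 0 -> Rabs (Arg (x / y)%C) <= PI / 2) -> 0 <= Re (x * Cconj y)%C.
Proof.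
  intros H.
  destruct (classic (x = RtoC 0)) as [-> | Hx]; [rewrite Cmult_0_l; simpl; lra|].
  destruct (classic (y = RtoC 0)) as [-> | Hy].
  { replace (x * Cconj 0)%C with (RtoC 0); [simpl; lra|].
    destruct x; unfold Cmult, Cconj; simpl. apply injective_projections; simpl; ring. }
  assert (Hm := proj1 (Cmod_gt_0 y) Hy).
  assert (Hq : (x / y)%C <> RtoC 0).
  { intros E. apply Hx. replace x with (x / y * y)%C by (field; exact Hy).
    rewrite E. ring. }
  assert (Hre := Arg_le_Re _ Hq (H Hx Hy)).
  replace (x * Cconj y)%C with (RtoC (Cmod y ^ 2) * (x / y))%C.
  2: { rewrite Cmod2_conj. field. exact Hy. }
  replace (Re (RtoC (Cmod y ^ 2) * (x / y))%C) with (Cmod y ^ 2 * Re (x / y)%C)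
    by (unfold Re, Cmult, RtoC; simpl; ring).
  apply Rmult_le_pos; [apply pow_le; lra | exact Hre].
Qed.

(** * Power series: coefficients and remainders *)

Definition psum (a : nat -> C) (K : nat) (z : C) : C := sum_n (fun n => a n * z ^ n)%C K.

Lemma psum_S a K z : psum a (S K) z = (psum a K z + a (S K) * z ^ S K)%C.
Proof. apply sum_n_SC. Qed.

Lemma psum_O a z : psum a 0 z = a 0%nat.
Proof. unfold psum. rewrite sum_O. simpl. ring. Qed.

Lemma pow_n_Cpow (z : C) n : pow_n (K := C_Ring) z n = (z ^ n)%C.
Proof. induction n as [|n IH]; [reflexivity|]. simpl. now rewrite IH. Qed.

Lemma is_pseries_psum (a : nat -> C) z l :
  is_pseries (K := C_AbsRing) (V := C_NormedModule) a z l -> Ccv (fun K => psum a K z) l.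
Proof.
  intros H. apply filterlim_Ccv in H.
  intros eps Heps. destruct (H eps Heps) as [n0 Hn]. exists n0. intros n Hle.
  specialize (Hn n Hle). unfold psum.
  replace (sum_n (fun n => a n * z ^ n)%C n)
    with (sum_n (fun k => scal (pow_n (K := C_AbsRing) z k) (a k)) n); [exact Hn|].
  apply sum_n_ext. intros k. change (scal (pow_n z k) (a k)) with (pow_n (K := C_Ring) z k * a k)%C.
  rewrite pow_n_Cpow. apply Cmult_comm.
Qed.

Lemma Ccv_const_tail (u : nat -> C) (l c : C) : Ccv u l -> (forall n, u n = c) -> l = c.
Proof.
  intros Hu Hc. apply Cmod_sub_0. apply Rle_antisym; [|apply Cmod_ge_0].
  apply le_epsilon. intros eps Heps. destruct (Hu eps Heps) as [n0 Hn].
  specialize (Hn n0 (le_n _)). rewrite Hc in Hn. rewrite Cmod_sub_sym. lra.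
Qed.

Lemma Ccv_bounded (u : nat -> C) l : Ccv u l -> exists B, 0 <= B /\ forall n, Cmod (u n) <= B.
Proof.
  intros Hu. destruct (Hu 1 Rlt_0_1) as [n0 Hn].
  assert (Hfin : exists B, 0 <= B /\ forall n, (n < n0)%nat -> Cmod (u n) <= B).
  { clear Hn. induction n0 as [|n0 (B & HB & H)]; [exists 0; split; [lra | intros; lia]|].
    exists (B + Cmod (u n0)). assert (H0 := Cmod_ge_0 (u n0)). split; [lra|].
    intros n Hlt. destruct (Nat.eq_dec n n0) as [-> | Hne]; [lra|].
    specialize (H n ltac:(lia)). lra. }
  destruct Hfin as (B & HB & H). assert (H0 := Cmod_ge_0 l).
  exists (B + (1 + Cmod l)). split; [lra|]. intros n.
  destruct (Nat.lt_ge_cases n n0) as [Hlt | Hge].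
  - specialize (H n Hlt). lra.
  - specialize (Hn n Hge). assert (H1 := Cmod_sub_le (u n) l). lra.
Qed.

Lemma psum_cv_coef_bound (a : nat -> C) (x : R) l : 0 <= x ->
  Ccv (fun K => psum a K (RtoC x)) l -> exists B, 0 <= B /\ forall n, Cmod (a n) * x ^ n <= B.
Proof.
  intros Hx H. destruct (Ccv_bounded _ _ H) as (B & HB & Hb).
  exists (2 * B). split; [lra|]. intros n.
  replace (Cmod (a n) * x ^ n) with (Cmod (a n * RtoC x ^ n)%C).
  2: { rewrite Cmod_mult, Cmod_pow, Cmod_R, Rabs_pos_eq by exact Hx. reflexivity. }
  destruct n as [|n].
  - specialize (Hb 0%nat). rewrite psum_O in Hb.
    replace (a 0%nat * RtoC x ^ 0)%C with (a 0%nat) by (simpl; ring). lra.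
  - replace (a (S n) * RtoC x ^ S n)%C with (psum a (S n) (RtoC x) - psum a n (RtoC x))%C
      by (rewrite psum_S; ring).
    assert (H1 := Hb n). assert (H2 := Hb (S n)).
    unfold Cminus. eapply Rle_trans; [apply Cmod_triangle|]. rewrite Cmod_opp. lra.
Qed.

(** The bound is uniform in z on the disk of radius q x. *)
Lemma psum_remainder (a : nat -> C) (x B q : R) (z l : C) (K : nat) :
  0 < x -> 0 <= q < 1 -> (forall n, Cmod (a n) * x ^ n <= B) -> Cmod z <= q * x ->
  Ccv (fun K => psum a K z) l -> Cmod (l - psum a K z) <= B * tail (S K) q.
Proof.
  intros Hx Hq HB Hz Hcv.
  assert (HB0 : 0 <= B).
  { specialize (HB 0%nat). simpl in HB. assert (H := Cmod_ge_0 (a 0%nat)). lra. }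
  assert (Hn : forall n, Cmod (psum a (K + n) z - psum a K z) <= B * (tail (S K) q - tail (S K + n) q)).
  { induction n as [|n IH].
    - rewrite !Nat.add_0_r. replace (psum a K z - psum a K z)%C with (RtoC 0) by ring.
      rewrite Cmod_0. lra.
    - replace (K + S n)%nat with (S (K + n)) by lia. rewrite psum_S.
      replace (S K + S n)%nat with (S (S (K + n))) by lia.
      replace (S K + n)%nat with (S (K + n)) in IH by lia.
      rewrite (tail_step (S (K + n)) q) in IH by lra.
      set (j := S (K + n)) in *.
      replace (psum a (K + n) z + a j * z ^ j - psum a K z)%C
        with ((psum a (K + n) z - psum a K z) + a j * z ^ j)%C by ring.
      eapply Rle_trans; [apply Cmod_triangle|].
      assert (Cmod (a j * z ^ j) <= B * q ^ j); [|lra].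
      rewrite Cmod_mult, Cmod_pow.
      apply Rle_trans with (Cmod (a j) * (q * x) ^ j).
      + apply Rmult_le_compat_l; [apply Cmod_ge_0|].
        apply pow_incr. split; [apply Cmod_ge_0 | exact Hz].
      + rewrite Rpow_mult_distr.
        replace (Cmod (a j) * (q ^ j * x ^ j)) with (Cmod (a j) * x ^ j * q ^ j) by ring.
        apply Rmult_le_compat_r; [apply pow_le; lra | apply HB]. }
  apply Ccv_bound with (u := fun n => (psum a (K + n) z - psum a K z)%C).
  - intros eps Heps. destruct (Hcv eps Heps) as [n0 Hn0]. exists n0. intros n Hle.
    replace (psum a (K + n) z - psum a K z - (l - psum a K z))%C
      with (psum a (K + n) z - l)%C by ring.
    apply Hn0. lia.
  - intros n. eapply Rle_trans; [apply Hn|].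
    assert (H := tail_ge0 (S K + n) q ltac:(lra)).
    apply Rmult_le_compat_l; [exact HB0 | lra].
Qed.

(** The remainder of order 2 is O(t^2), so the derivative at 0 is a_1; it suffices
    to compare both first order expansions at one small real point t. *)
Lemma classA_coefs (A : C -> C) (a : nat -> C) : classA A ->
  (forall z, disk 1 z -> Ccv (fun K => psum a K z) (A z)) ->
  a 0%nat = RtoC 0 /\ a 1%nat = RtoC 1.
Proof.
  intros (_ & H0 & Hd) Hcv.
  assert (Ha0 : a 0%nat = RtoC 0).
  { rewrite <- H0. symmetry. apply Ccv_const_tail with (fun K => psum a K (RtoC 0)).
    - apply Hcv. unfold disk. rewrite Cmod_0. lra.
    - induction n as [|n IH]; [apply psum_O|]. rewrite psum_S, IH, Cpow_S. ring. }
  split; [exact Ha0|].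
  destruct (psum_cv_coef_bound a (1 / 2) (A (RtoC (1 / 2)))) as (B & HB & Hb); [lra | |].
  { apply Hcv. unfold disk. rewrite Cmod_R, Rabs_pos_eq; lra. }
  apply Cmod_sub_0. apply Rle_antisym; [|apply Cmod_ge_0].
  apply le_epsilon. intros eps Heps. rewrite Rplus_0_l.
  destruct Hd as [_ Hd].
  specialize (Hd (RtoC 0) (fun P H => H) (mkposreal (eps / 2) ltac:(lra))).
  destruct Hd as [[d Hdpos] Hd].
  change (forall y, Cmod (y - RtoC 0) < d ->
    Cmod (A y - A (RtoC 0) - (y - RtoC 0) * RtoC 1) <= eps / 2 * Cmod (y - RtoC 0)) in Hd.
  (* t inside the disk where the difference quotient is eps/2-close to 1, in the range
     of the remainder estimate with q = 2 t <= 1/2, and with 8 B t <= eps/2 *)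
  set (t := Rmin (Rmin (d / 2) (1 / 4)) (eps / (16 * (B + 1)))).
  assert (Ht : 0 < t).
  { unfold t. repeat apply Rmin_glb_lt; try lra. apply Rdiv_lt_0_compat; lra. }
  assert (Ht1 : t <= d / 2) by (eapply Rle_trans; [apply Rmin_l | apply Rmin_l]).
  assert (Ht2 : t <= 1 / 4) by (eapply Rle_trans; [apply Rmin_l | apply Rmin_r]).
  assert (Ht3 : 16 * (B * t) <= eps).
  { assert (t <= eps / (16 * (B + 1))) by apply Rmin_r.
    assert (t * (16 * (B + 1)) <= eps).
    { apply Rmult_le_compat_r with (r := 16 * (B + 1)) in H; [|lra].
      unfold Rdiv in H. rewrite Rmult_assoc, Rinv_l in H by lra. lra. }
    nra. }
  assert (Hmt : Cmod (RtoC t) = t) by (rewrite Cmod_R, Rabs_pos_eq; lra).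
  assert (H1 : Cmod (A (RtoC t) - RtoC t) <= eps / 2 * t).
  { specialize (Hd (RtoC t)).
    replace (RtoC t - RtoC 0)%C with (RtoC t) in Hd by ring.
    rewrite Hmt in Hd. specialize (Hd ltac:(lra)).
    rewrite H0 in Hd.
    replace (A (RtoC t) - RtoC t)%C with (A (RtoC t) - RtoC 0 - RtoC t * RtoC 1)%C by ring.
    exact Hd. }
  assert (H2 : Cmod (A (RtoC t) - psum a 1 (RtoC t)) <= B * tail 2 (2 * t)).
  { apply psum_remainder with (1 / 2); try lra; [exact Hb | apply Hcv; unfold disk; lra]. }
  rewrite psum_S, psum_O, Ha0 in H2.
  assert (H3 : tail 2 (2 * t) <= 8 * t * t).
  { unfold tail. apply Rmult_le_reg_r with (1 - 2 * t); [lra|].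
    unfold Rdiv. rewrite Rmult_assoc, Rinv_l by lra. simpl. nra. }
  assert (H4 : Cmod (a 1%nat - 1) * t <= (eps / 2 + 8 * B * t) * t).
  { rewrite <- Hmt at 1. rewrite <- Cmod_mult.
    replace ((a 1%nat - 1) * RtoC t)%C
      with ((A (RtoC t) - RtoC t) + - (A (RtoC t) - (0 + a 1%nat * RtoC t ^ 1)))%C
      by (simpl; ring).
    eapply Rle_trans; [apply Cmod_triangle|]. rewrite Cmod_opp.
    assert (B * tail 2 (2 * t) <= B * (8 * t * t)) by (apply Rmult_le_compat_l; assumption).
    lra. }
  apply Rmult_le_reg_r in H4; [lra | exact Ht].
Qed.

(** * The rows (conj z)^k A_k(z) *)

Lemma mono_lipschitz (n k : nat) (rho : R) (z w : C) :
  Cmod z <= rho -> Cmod w <= rho ->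
  Cmod (z ^ n * Cconj z ^ k - w ^ n * Cconj w ^ k) <= INR (n + k) * rho ^ pred (n + k) * Cmod (z - w).
Proof.
  intros Hz Hw. assert (Hrho : 0 <= rho) by (assert (H := Cmod_ge_0 z); lra).
  assert (Hmod : forall n k y, Cmod y <= rho -> Cmod (y ^ n * Cconj y ^ k) <= rho ^ (n + k)).
  { intros n' k' y Hy. rewrite Cmod_mult, !Cmod_pow, Cmod_conj, <- pow_add.
    apply pow_incr. split; [apply Cmod_ge_0 | exact Hy]. }
  (* split off one factor x, which is z or its conjugate, from a product u of m factors *)
  assert (Hstep : forall m u v x y, Cmod x <= rho ->  Cmod v <= rho ^ m ->
     Cmod (x - y) <= Cmod (z - w) -> Cmod (u - v) <= INR m * rho ^ pred m * Cmod (z - w) ->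
     Cmod (x * u - y * v) <= INR (S m) * rho ^ m * Cmod (z - w)).
  { intros m u v x y Hx Hv Hxy Huv.
    replace (x * u - y * v)%C with (x * (u - v) + (x - y) * v)%C by ring.
    eapply Rle_trans; [apply Cmod_triangle|]. rewrite !Cmod_mult, S_INR.
    assert (Cmod x * Cmod (u - v) <= rho * (INR m * rho ^ pred m * Cmod (z - w)))
      by (apply Rmult_le_compat; auto using Cmod_ge_0).
    assert (Cmod (x - y) * Cmod v <= Cmod (z - w) * rho ^ m)
      by (apply Rmult_le_compat; auto using Cmod_ge_0).
    replace (rho * (INR m * rho ^ pred m * Cmod (z - w))) with (INR m * rho ^ m * Cmod (z - w)) in H.
    - lra.
    - destruct m; simpl; ring. }
  induction n as [|n IHn].
  - induction k as [|k IHk].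
    + simpl. replace (1 * 1 - 1 * 1)%C with (RtoC 0) by ring. rewrite Cmod_0. lra.
    + rewrite !Cpow_S. simpl Nat.add. simpl pred.
      replace (z ^ 0 * (Cconj z * Cconj z ^ k))%C with (Cconj z * (z ^ 0 * Cconj z ^ k))%C by ring.
      replace (w ^ 0 * (Cconj w * Cconj w ^ k))%C with (Cconj w * (w ^ 0 * Cconj w ^ k))%C by ring.
      apply Hstep; auto.
      * now rewrite Cmod_conj.
      * rewrite <- Cminus_conj, Cmod_conj. lra.
  - rewrite !Cpow_S, <- !Cmult_assoc. apply Hstep; auto. lra.
Qed.

(** One row, compared with its leading term (conj z)^k z: the estimates are
    telescoping for the partial sums and pass to the limit. *)
Section Row.
Variables (a : nat -> C) (k : nat) (N rho : R).
Hypothesis HN : 0 <= N.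
Hypothesis Hrho : 0 <= rho < 1.
Hypothesis Ha0 : a 0%nat = RtoC 0.
Hypothesis Ha1 : a 1%nat = RtoC 1.
Hypothesis Ha : forall n, (2 <= n)%nat -> Cmod (a n) <= N.

Lemma row_psum_lipschitz K z w : Cmod z <= rho -> Cmod w <= rho ->
  Cmod ((Cconj z ^ k * psum a (S K) z - Cconj z ^ k * z)
      - (Cconj w ^ k * psum a (S K) w - Cconj w ^ k * w))
  <= N * (dtail (S k) rho - dtail (S k + K) rho) * Cmod (z - w).
Proof.
  intros Hz Hw. induction K as [|K IH].
  - rewrite !psum_S, !psum_O, Ha0, Ha1, Nat.add_0_r.
    match goal with |- Cmod ?e <= _ => replace e with (RtoC 0) by (simpl; ring) end.
    rewrite Cmod_0. lra.
  - rewrite !(psum_S a (S K)).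
    replace (S k + K)%nat with (S (k + K)) in IH by lia.
    replace (S k + S K)%nat with (S (S (k + K))) by lia.
    rewrite (dtail_step (S (k + K))) in IH by lra.
    match goal with |- Cmod ?e <= _ => replace e with
      (((Cconj z ^ k * psum a (S K) z - Cconj z ^ k * z)
      - (Cconj w ^ k * psum a (S K) w - Cconj w ^ k * w))
      + a (S (S K)) * (z ^ S (S K) * Cconj z ^ k - w ^ S (S K) * Cconj w ^ k))%C by ring end.
    eapply Rle_trans; [apply Cmod_triangle|]. rewrite Cmod_mult.
    assert (Hm := mono_lipschitz (S (S K)) k rho z w Hz Hw).
    replace (S (S K) + k)%nat with (S (S (k + K))) in Hm by lia. simpl pred in Hm.
    assert (Ht : Cmod (a (S (S K))) * Cmod (z ^ S (S K) * Cconj z ^ k - w ^ S (S K) * Cconj w ^ k)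
      <= N * (INR (S (S (k + K))) * rho ^ S (k + K) * Cmod (z - w)))
      by (apply Rmult_le_compat; [apply Cmod_ge_0.. | apply Ha; lia | exact Hm]).
    lra.
Qed.

Lemma row_psum_bound K z : Cmod z <= rho ->
  Cmod (Cconj z ^ k * psum a (S K) z - Cconj z ^ k * z)
  <= N * (tail (S (S k)) rho - tail (S (S k) + K) rho).
Proof.
  intros Hz. induction K as [|K IH].
  - rewrite !psum_S, !psum_O, Ha0, Ha1, Nat.add_0_r.
    match goal with |- Cmod ?e <= _ => replace e with (RtoC 0) by (simpl; ring) end.
    rewrite Cmod_0. lra.
  - rewrite !(psum_S a (S K)).
    replace (S (S k) + K)%nat with (S (S (k + K))) in IH by lia.
    replace (S (S k) + S K)%nat with (S (S (S (k + K)))) by lia.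
    rewrite (tail_step (S (S (k + K)))) in IH by lra.
    match goal with |- Cmod ?e <= _ => replace e with
      ((Cconj z ^ k * psum a (S K) z - Cconj z ^ k * z)
      + a (S (S K)) * (z ^ S (S K) * Cconj z ^ k))%C by ring end.
    eapply Rle_trans; [apply Cmod_triangle|].
    rewrite !Cmod_mult, !Cmod_pow, Cmod_conj, <- pow_add.
    replace (S (S K) + k)%nat with (S (S (k + K))) by lia.
    assert (Hp : Cmod z ^ S (S (k + K)) <= rho ^ S (S (k + K)))
      by (apply pow_incr; split; [apply Cmod_ge_0 | exact Hz]).
    assert (Ht : Cmod (a (S (S K))) * Cmod z ^ S (S (k + K)) <= N * rho ^ S (S (k + K)))
      by (apply Rmult_le_compat; [apply Cmod_ge_0 | apply pow_le, Cmod_ge_0 | apply Ha; lia | exact Hp]).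
    lra.
Qed.

Variable A : C -> C.
Hypothesis Hcv : forall z, disk 1 z -> Ccv (fun K => psum a K z) (A z).

Lemma row_lipschitz z w : Cmod z <= rho -> Cmod w <= rho ->
  Cmod ((Cconj z ^ k * A z - Cconj z ^ k * z) - (Cconj w ^ k * A w - Cconj w ^ k * w))
  <= N * dtail (S k) rho * Cmod (z - w).
Proof.
  intros Hz Hw.
  apply Ccv_bound with (u := fun K => ((Cconj z ^ k * psum a (S K) z - Cconj z ^ k * z)
      - (Cconj w ^ k * psum a (S K) w - Cconj w ^ k * w))%C).
  - intros eps Heps.
    destruct (Hcv z ltac:(unfold disk; lra) (eps / 2) ltac:(lra)) as [n1 H1].
    destruct (Hcv w ltac:(unfold disk; lra) (eps / 2) ltac:(lra)) as [n2 H2].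
    exists (n1 + n2)%nat. intros n Hn.
    specialize (H1 (S n) ltac:(lia)). specialize (H2 (S n) ltac:(lia)).
    match goal with |- Cmod ?e < _ => replace e with
      (Cconj z ^ k * (psum a (S n) z - A z) + - (Cconj w ^ k * (psum a (S n) w - A w)))%C by ring end.
    eapply Rle_lt_trans; [apply Cmod_triangle|].
    rewrite Cmod_opp, !Cmod_mult, !Cmod_pow, !Cmod_conj.
    assert (Hp : forall y, Cmod y <= rho -> 0 <= Cmod y ^ k <= 1)
      by (intros y Hy; apply pow_le_1; split; [apply Cmod_ge_0 | lra]).
    assert (Hpz := Hp z Hz). assert (Hpw := Hp w Hw).
    assert (H3 := Cmod_ge_0 (psum a (S n) z - A z)).
    assert (H4 := Cmod_ge_0 (psum a (S n) w - A w)). nra.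
  - intros K. eapply Rle_trans; [apply row_psum_lipschitz; assumption|].
    apply Rmult_le_compat_r; [apply Cmod_ge_0|].
    apply Rmult_le_compat_l; [exact HN|].
    assert (H := dtail_ge0 (S k + K) rho Hrho). lra.
Qed.

Lemma row_bound z : Cmod z <= rho ->
  Cmod (Cconj z ^ k * A z - Cconj z ^ k * z) <= N * tail (S (S k)) rho.
Proof.
  intros Hz.
  apply Ccv_bound with (u := fun K => (Cconj z ^ k * psum a (S K) z - Cconj z ^ k * z)%C).
  - intros eps Heps.
    destruct (Hcv z ltac:(unfold disk; lra) eps Heps) as [n1 H1].
    exists n1. intros n Hn. specialize (H1 (S n) ltac:(lia)).
    match goal with |- Cmod ?e < _ => replace e with
      (Cconj z ^ k * (psum a (S n) z - A z))%C by ring end.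
    rewrite Cmod_mult, Cmod_pow, Cmod_conj.
    assert (Hp : 0 <= Cmod z ^ k <= 1) by (apply pow_le_1; split; [apply Cmod_ge_0 | lra]).
    assert (H3 := Cmod_ge_0 (psum a (S n) z - A z)). nra.
  - intros K. eapply Rle_trans; [apply row_psum_bound; assumption|].
    apply Rmult_le_compat_l; [exact HN|].
    assert (H := tail_ge0 (S (S k) + K) rho Hrho). lra.
Qed.
End Row.

(** * Coefficient bounds for bounded polyanalytic functions *)

Lemma bernoulli_le (r : R) p : 0 <= r <= 1 -> 1 - INR p * (1 - r) <= r ^ p.
Proof.
  intros H. induction p as [|p IH]; [simpl; lra|].
  rewrite S_INR. simpl pow. assert (Hp := pos_INR p).
  assert (r * (1 - INR p * (1 - r)) <= r * r ^ p) by (apply Rmult_le_compat_l; lra).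
  assert (0 <= INR p * (1 - r) * (1 - r)) by (repeat apply Rmult_le_pos; lra).
  nra.
Qed.

(** Let r tend to 1, by the Bernoulli inequality [bernoulli_le]. *)
Lemma le_of_pow_le (X Y : R) p : 0 <= X ->
  (forall r, 0 < r < 1 -> r ^ p * X <= Y) -> X <= Y.
Proof.
  intros HX H. apply le_epsilon. intros eps Heps.
  assert (Hp := pos_INR p).
  assert (HD : 0 < (INR p + 1) * (X + 1)) by nra.
  set (d := Rmin (1 / 2) (eps / ((INR p + 1) * (X + 1)))).
  assert (Hd : 0 < d) by (apply Rmin_glb_lt; [lra | apply Rdiv_lt_0_compat; lra]).
  assert (Hd1 : d <= 1 / 2) by apply Rmin_l.
  assert (Hd2 : d * ((INR p + 1) * (X + 1)) <= eps).
  { assert (Hd2 : d <= eps / ((INR p + 1) * (X + 1))) by apply Rmin_r.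
    apply Rmult_le_compat_r with (r := (INR p + 1) * (X + 1)) in Hd2; [|lra].
    unfold Rdiv in Hd2. rewrite Rmult_assoc, Rinv_l in Hd2 by lra. lra. }
  assert (H1 := H (1 - d) ltac:(lra)).
  assert (H2 := bernoulli_le (1 - d) p ltac:(lra)).
  assert (H3 : (1 - INR p * (1 - (1 - d))) * X <= (1 - d) ^ p * X)
    by (apply Rmult_le_compat_r; assumption).
  assert (0 <= INR p * d) by (apply Rmult_le_pos; lra).
  assert (INR p * X * d <= d * ((INR p + 1) * (X + 1))) by nra.
  lra.
Qed.

Lemma sum_n_indicator (x : R) k0 b : (k0 <= b)%nat ->
  sum_n (fun k => 1 + (if Nat.eqb k k0 then x else 0)) b = INR (S b) + x.
Proof.
  assert (H : forall n, sum_n (fun k => 1 + (if Nat.eqb k k0 then x else 0)) n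
    = INR (S n) + (if Nat.leb k0 n then x else 0)).
  { induction n as [|n IH].
    - rewrite sum_O. destruct k0; simpl; lra.
    - rewrite sum_n_SR, IH, (S_INR (S n)).
      destruct (Nat.leb_spec k0 n), (Nat.eqb_spec (S n) k0), (Nat.leb_spec k0 (S n)); lra || lia. }
  intros Hk. rewrite H. destruct (Nat.leb_spec k0 b); lra || lia.
Qed.

Section Polyanalytic.
Variables (b : nat) (A : nat -> C -> C) (a : nat -> nat -> C) (F : C -> C).
Hypothesis Ha0 : forall k, (k <= b)%nat -> a 0%nat k = RtoC 0.
Hypothesis Ha1 : forall k, (k <= b)%nat -> a 1%nat k = RtoC 1.
Hypothesis Hcv : forall k, (k <= b)%nat -> forall z, disk 1 z ->
  Ccv (fun K => psum (fun n => a n k) K z) (A k z).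
Hypothesis HF : forall z, disk 1 z -> F z = sum_n (fun k => (Cconj z ^ k * A k z)%C) b.
Hypothesis Hsign : forall n n' k k', (k <= b)%nat -> (k' <= b)%nat -> k <> k' -> n <> n' ->
  0 <= Re (a n k * Cconj (a n' k'))%C.

Lemma coef_growth x : 0 < x < 1 ->
  exists B, 0 <= B /\ forall k, (k <= b)%nat -> forall n, Cmod (a n k) * x ^ n <= B.
Proof.
  intros Hx.
  assert (H : forall m, (m <= b)%nat -> exists B, 0 <= B /\
     forall k, (k <= m)%nat -> forall n, Cmod (a n k) * x ^ n <= B).
  { assert (H1 : forall k, (k <= b)%nat -> exists B, 0 <= B /\ forall n, Cmod (a n k) * x ^ n <= B).
    { intros k Hk. apply psum_cv_coef_bound with (A k (RtoC x)) ; [lra|].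
      apply (Hcv k Hk). unfold disk. rewrite Cmod_R, Rabs_pos_eq; lra. }
    induction m as [|m IH]; intros Hm.
    - destruct (H1 0%nat Hm) as (B & HB & HB'). exists B. split; [exact HB|].
      intros k Hk. replace k with 0%nat by lia. exact HB'.
    - destruct (IH ltac:(lia)) as (B & HB & HB'). destruct (H1 (S m) Hm) as (B2 & HB2 & HB2').
      exists (B + B2). split; [lra|]. intros k Hk n.
      destruct (Nat.eq_dec k (S m)) as [->|Hne].
      + specialize (HB2' n). lra.
      + specialize (HB' k ltac:(lia) n). lra. }
  apply (H b). lia.
Qed.

(** On |z| = r the remainders of the rows are geometric of ratio
    q = r / x, for any radius x strictly between r and 1. *)
Lemma truncation_uniform r : 0 < r < 1 -> forall eps, 0 < eps -> exists K0,
  forall K, (K0 <= K)%nat -> forall z, Cmod z = r ->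
  Cmod (F z - sum_n (fun k => Cconj z ^ k * psum (fun n => a n k) K z)%C b) <= eps.
Proof.
  intros Hr eps Heps.
  set (x := (1 + r) / 2). assert (Hx : 0 < x < 1) by (unfold x; lra).
  destruct (coef_growth x Hx) as (B & HB & HBa).
  set (q := r / x).
  assert (Hq : 0 <= q < 1).
  { unfold q. split; [apply Rlt_le, Rdiv_lt_0_compat; lra|].
    apply Rmult_lt_reg_r with x; [lra|]. unfold Rdiv. rewrite Rmult_assoc, Rinv_l by lra.
    unfold x. lra. }
  assert (Hqx : q * x = r) by (unfold q; field; lra).
  set (D := INR (S b) * B / (1 - q)).
  assert (HD : 0 <= D).
  { unfold D. apply Rmult_le_pos; [apply Rmult_le_pos; [apply pos_INR | exact HB]|].
    apply Rlt_le, Rinv_0_lt_compat; lra. }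
  destruct (pow_lt_1_zero q ltac:(rewrite Rabs_pos_eq; lra) (eps / (D + 1))
    ltac:(apply Rdiv_lt_0_compat; lra)) as [K0 HK0].
  exists K0. intros K HK z Hz.
  rewrite HF by (unfold disk; lra). rewrite sum_n_minusC.
  eapply Rle_trans; [apply Cmod_sum_n_le|].
  apply Rle_trans with (sum_n (fun _ => B * tail (S K) q) b).
  - apply sum_n_le_loc. intros k Hk.
    replace (Cconj z ^ k * A k z - Cconj z ^ k * psum (fun n => a n k) K z)%C
      with (Cconj z ^ k * (A k z - psum (fun n => a n k) K z))%C by ring.
    rewrite Cmod_mult, Cmod_pow, Cmod_conj.
    assert (H1 : Cmod (A k z - psum (fun n => a n k) K z) <= B * tail (S K) q).
    { apply psum_remainder with x; try lra; [apply (HBa k Hk) | apply (Hcv k Hk); unfold disk; lra]. }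
    assert (Hp : 0 <= Cmod z ^ k <= 1) by (apply pow_le_1; split; [apply Cmod_ge_0 | lra]).
    assert (H3 := Cmod_ge_0 (A k z - psum (fun n => a n k) K z)). nra.
  - rewrite sum_n_const.
    replace (INR (S b) * (B * tail (S K) q)) with (D * q ^ S K)
      by (unfold D, tail; field; lra).
    specialize (HK0 (S K) ltac:(lia)).
    rewrite Rabs_pos_eq in HK0 by (apply pow_le; lra).
    assert (H : (D + 1) * q ^ S K <= (D + 1) * (eps / (D + 1))) by (apply Rmult_le_compat_l; lra).
    replace ((D + 1) * (eps / (D + 1))) with eps in H by (field; lra).
    assert (0 <= q ^ S K) by (apply pow_le; lra). lra.
Qed.

(** Parseval for the truncated series on |z| = r, where |F| <= M up to eps; only
    the coefficients a_(1,k) = 1 and a_(n0,k0) are kept, all with weights at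
    least r^p, p = 2 (n0 + b).  Then eps tends to 0 and r to 1. *)
Lemma coef_square_bound M k0 n0 : 0 <= M -> (forall z, disk 1 z -> Cmod (F z) <= M) ->
  (k0 <= b)%nat -> (2 <= n0)%nat -> INR (S b) + Cmod (a n0 k0) ^ 2 <= M ^ 2.
Proof.
  intros HM HFM Hk0 Hn0.
  set (p := (2 * (n0 + b))%nat).
  apply le_of_pow_le with p.
  { assert (H1 := pos_INR (S b)). assert (H2 := pow2_ge_0 (Cmod (a n0 k0))). lra. }
  intros r Hr.
  assert (Hall : forall eps, 0 < eps -> r ^ p * (INR (S b) + Cmod (a n0 k0) ^ 2) <= (M + eps) ^ 2).
  { intros eps Heps.
    destruct (truncation_uniform r Hr eps Heps) as [K0 HK0].
    set (K := (K0 + n0)%nat).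
    set (c := fun n k => (a n k * RtoC (r ^ (n + k)))%C).
    apply Rle_trans with (sum_n (fun k => sum_n (fun n => Cmod (c n k) ^ 2) K) b).
    - rewrite <- (sum_n_indicator _ k0 b Hk0), <- (sum_n_mult_l (K := R_Ring)).
      apply sum_n_le_loc. intros k Hk. change mult with Rmult.
      assert (Hc : forall n, Cmod (c n k) ^ 2 = r ^ (2 * (n + k)) * Cmod (a n k) ^ 2).
      { intros n. unfold c. rewrite Cmod_mult, Cmod_R, Rabs_pos_eq by (apply pow_le; lra).
        rewrite Rpow_mult_distr, <- pow_mult, (Nat.mul_comm (n + k)). ring. }
      assert (Hpw : forall n, (n <= n0)%nat -> r ^ p * Cmod (a n k) ^ 2 <= Cmod (c n k) ^ 2).
      { intros n Hn. rewrite Hc. apply Rmult_le_compat_r; [apply pow2_ge_0|].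
        unfold p. replace (2 * (n0 + b))%nat with (2 * (n + k) + (2 * (n0 + b) - 2 * (n + k)))%nat by lia.
        rewrite pow_add. set (e := (2 * (n0 + b) - 2 * (n + k))%nat).
        assert (0 <= r ^ (2 * (n + k))) by (apply pow_le; lra).
        assert (r ^ e <= 1) by (rewrite <- (pow1 e); apply pow_incr; lra). nra. }
      assert (H1 := Hpw 1%nat ltac:(lia)). rewrite (Ha1 k Hk), Cmod_1, pow1 in H1.
      assert (Hge : forall n, (n <= K)%nat -> 0 <= Cmod (c n k) ^ 2) by (intros; apply pow2_ge_0).
      destruct (Nat.eqb_spec k k0) as [->|Hne].
      + assert (H2 := Hpw n0 (le_n _)).
        assert (H3 := sum_n_ge_two_terms _ K 1 n0 Hge ltac:(unfold K; lia)). cbv beta in H3. lra.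
      + assert (H3 := sum_n_ge_term _ K 1 Hge ltac:(unfold K; lia)). cbv beta in H3. lra.
    - apply parseval_le; [lra | |].
      + intros n n' k k' Hk Hk' _ _ Hkk Hnn. unfold c.
        assert (Hs := Hsign n n' k k' Hk Hk' Hkk Hnn).
        assert (0 <= r ^ (n + k) * r ^ (n' + k')) by (apply Rmult_le_pos; apply pow_le; lra).
        replace (a n k * RtoC (r ^ (n + k)) * Cconj (a n' k' * RtoC (r ^ (n' + k'))))%C
          with (RtoC (r ^ (n + k) * r ^ (n' + k')) * (a n k * Cconj (a n' k')))%C.
        2: { rewrite Cmult_conj, RtoC_mult.
             replace (Cconj (RtoC (r ^ (n' + k')))) with (RtoC (r ^ (n' + k'))).
             - ring.
             - unfold Cconj, RtoC; simpl. now rewrite Ropp_0. }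
        set (y := (a n k * Cconj (a n' k'))%C) in *.
        replace (Re (RtoC (r ^ (n + k) * r ^ (n' + k')) * y)%C)
          with (r ^ (n + k) * r ^ (n' + k') * Re y) by (unfold Re, Cmult, RtoC; simpl; ring).
        apply Rmult_le_pos; assumption.
      + intros z Hz.
        assert (Hrz : Cmod (RtoC r * z) = r) by (rewrite Cmod_mult, Hz, Cmod_R, Rabs_pos_eq; lra).
        assert (H1 := HK0 K ltac:(unfold K; lia) (RtoC r * z)%C Hrz).
        assert (H2 := HFM (RtoC r * z)%C ltac:(unfold disk; lra)).
        replace (sum_n (fun k => sum_n (fun n => mono (c n k) n k z) K) b)
          with (sum_n (fun k => Cconj (RtoC r * z) ^ k * psum (fun n => a n k) K (RtoC r * z))%C b).
        { rewrite Cmod_sub_sym in H1.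
          eapply Rle_trans; [apply Cmod_sub_le with (y := F (RtoC r * z)%C) |]. lra. }
        apply sum_n_ext. intros k. unfold psum. rewrite sum_n_Cmult_l.
        apply sum_n_ext. intros n. unfold mono, c.
        rewrite Cmult_conj.
        replace (Cconj (RtoC r)) with (RtoC r) by (unfold Cconj, RtoC; simpl; now rewrite Ropp_0).
        rewrite !Cpow_mult_l, RtoC_pow, Cpow_add_r. match goal with |- ?x = ?y => change (@eq C x y) end. ring. }
  apply Rnot_lt_le. intros Hlt.
  set (X := r ^ p * (INR (S b) + Cmod (a n0 k0) ^ 2)) in *.
  (* e is so small that 2 M e + e^2 < X - M^2, using e <= 1 *)
  set (e := Rmin 1 ((X - M ^ 2) / (2 * (2 * M + 1)))).
  assert (He : 0 < e) by (apply Rmin_glb_lt; [lra | apply Rdiv_lt_0_compat; lra]).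
  assert (He1 : e <= 1) by apply Rmin_l.
  assert (He2 : e * (2 * (2 * M + 1)) <= X - M ^ 2).
  { assert (He2 : e <= (X - M ^ 2) / (2 * (2 * M + 1))) by apply Rmin_r.
    apply Rmult_le_compat_r with (r := 2 * (2 * M + 1)) in He2; [|lra].
    unfold Rdiv in He2. rewrite Rmult_assoc, Rinv_l in He2 by lra. lra. }
  specialize (Hall e He). nra.
Qed.

Lemma coef_modulus_bound M k n : 0 <= M -> (forall z, disk 1 z -> Cmod (F z) <= M) ->
  (k <= b)%nat -> (2 <= n)%nat -> Cmod (a n k) <= sqrt (M ^ 2 - INR (S b)).
Proof.
  intros HM HFM Hk Hn. assert (H := coef_square_bound M k n HM HFM Hk Hn).
  rewrite <- (sqrt_pow2 (Cmod (a n k))) by apply Cmod_ge_0.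
  apply sqrt_le_1_alt. lra.
Qed.

(** * The perturbation F - id *)

(** In the row k = 0 the leading term is z itself and cancels. *)
Lemma perturbation_split z : disk 1 z ->
  (F z - z)%C = sum_n (fun k => (Cconj z ^ k * A k z - Cconj z ^ k * z)
     + match k with O => 0 | S _ => Cconj z ^ k * z end)%C b.
Proof.
  intros Hz. rewrite HF by exact Hz.
  assert (H : forall n, (sum_n (fun k => Cconj z ^ k * A k z) n - z)%C =
    sum_n (fun k => (Cconj z ^ k * A k z - Cconj z ^ k * z)
     + match k with O => 0 | S _ => Cconj z ^ k * z end)%C n).
  { induction n as [|n IH].
    - rewrite !sum_O. simpl. ring.
    - rewrite !sum_n_SC, <- IH. ring. }
  apply H.
Qed.

Lemma perturbation_lipschitz N rho z w : 0 <= N -> 0 <= rho < 1 ->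
  (forall k n, (k <= b)%nat -> (2 <= n)%nat -> Cmod (a n k) <= N) ->
  Cmod z <= rho -> Cmod w <= rho ->
  Cmod ((F z - z) - (F w - w)) <= lip_bound b N rho * Cmod (z - w).
Proof.
  intros HN Hrho HaN Hz Hw.
  rewrite !perturbation_split by (unfold disk; lra). rewrite sum_n_minusC.
  eapply Rle_trans; [apply Cmod_sum_n_le|].
  unfold lip_bound. rewrite <- (sum_n_mult_r (K := R_Ring)).
  apply sum_n_le_loc. intros k Hk. change mult with Rmult.
  assert (Hrow := row_lipschitz (fun n => a n k) k N rho HN Hrho (Ha0 k Hk) (Ha1 k Hk)
    (fun n => HaN k n Hk) (A k) (Hcv k Hk) z w Hz Hw).
  set (R1 := (Cconj z ^ k * A k z - Cconj z ^ k * z)%C) in *.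
  set (R2 := (Cconj w ^ k * A k w - Cconj w ^ k * w)%C) in *.
  assert (Hlead : Cmod (match k with O => 0 | S _ => Cconj z ^ k * z end
     - match k with O => 0 | S _ => Cconj w ^ k * w end)%C <= lip_lead k rho * Cmod (z - w)).
  { destruct k as [|k].
    - replace (0 - 0)%C with (RtoC 0) by ring. rewrite Cmod_0. simpl. lra.
    - assert (H := mono_lipschitz 1 (S k) rho z w Hz Hw).
      replace (Cconj z ^ S k * z)%C with (z ^ 1 * Cconj z ^ S k)%C by (rewrite Cpow_1_r; ring).
      replace (Cconj w ^ S k * w)%C with (w ^ 1 * Cconj w ^ S k)%C by (rewrite Cpow_1_r; ring).
      exact H. }
  match goal with |- Cmod (R1 + ?x - (R2 + ?y)) <= _ =>
    replace (R1 + x - (R2 + y))%C with ((R1 - R2) + (x - y))%C by ring end.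
  eapply Rle_trans; [apply Cmod_triangle|]. lra.
Qed.

Lemma perturbation_bound N rho z : 0 <= N -> 0 <= rho < 1 ->
  (forall k n, (k <= b)%nat -> (2 <= n)%nat -> Cmod (a n k) <= N) ->
  Cmod z <= rho -> Cmod (F z - z) <= sup_bound b N rho.
Proof.
  intros HN Hrho HaN Hz.
  rewrite perturbation_split by (unfold disk; lra).
  eapply Rle_trans; [apply Cmod_sum_n_le|].
  apply sum_n_le_loc. intros k Hk.
  assert (Hrow := row_bound (fun n => a n k) k N rho HN Hrho (Ha0 k Hk) (Ha1 k Hk)
    (fun n => HaN k n Hk) (A k) (Hcv k Hk) z Hz).
  assert (Hlead : Cmod (match k with O => 0 | S _ => Cconj z ^ k * z end)%C <= sup_lead k rho).
  { destruct k as [|k].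
    - rewrite Cmod_0. simpl. lra.
    - rewrite Cmod_mult, Cmod_pow, Cmod_conj. unfold sup_lead.
      replace (Cmod z ^ S k * Cmod z) with (Cmod z ^ S (S k)) by (simpl; ring).
      apply pow_incr. split; [apply Cmod_ge_0 | exact Hz]. }
  eapply Rle_trans; [apply Cmod_triangle|]. lra.
Qed.

Lemma univalent_schlicht M r : sqrt (INR (S b)) <= M ->
  (forall z, disk 1 z -> Cmod (F z) <= M) ->
  least_positive_root (radius_fun (S b) M) r ->
  univalent_on (disk r) F /\
  image_contains_schlicht_disk F (disk r) (schlicht_radius (S b) M r).
Proof.
  intros HM HFM Hr.
  assert (Hr1 := least_root_lt_1 b M r HM Hr).
  assert (Hlt := fun x => lip_bound_lt_1 b M r x HM Hr).
  destruct Hr as (Hr0 & Er & _).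
  assert (HM0 : 0 <= M) by (assert (H := sqrt_pos (INR (S b))); lra).
  rewrite radius_fun_lip in Er by lra. rewrite schlicht_radius_sup by lra.
  assert (HaN := fun k n => coef_modulus_bound M k n HM0 HFM).
  set (N := sqrt (M ^ 2 - INR (S b))) in *.
  assert (HN : 0 <= N) by apply sqrt_pos.
  assert (Hg0 := sup_bound_ge0 b N HN r ltac:(lra)).
  assert (Hg := sup_bound_le_lip b N HN r ltac:(lra)).
  assert (H01 : forall rho, 0 <= rho < r -> 0 <= lip_bound b N rho < 1).
  { intros rho Hrho. split; [|apply Hlt, Hrho].
    rewrite <- (lip_bound_0 b N) at 1. apply lip_bound_incr; auto; lra. }
  assert (HL : forall rho z w, 0 <= rho < r -> Cmod z <= rho -> Cmod w <= rho ->
    Cmod ((F z - z) - (F w - w)) <= lip_bound b N rho * Cmod (z - w)).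
  { intros rho z w Hrho. apply perturbation_lipschitz; auto; lra. }
  split.
  - apply perturbed_id_univalent with (lip_bound b N); assumption.
  - apply perturbed_id_schlicht with (lip_bound b N) (sup_bound b N); try assumption.
    + intros rho z Hrho. apply perturbation_bound; auto; lra.
    + nra.
    + intros rho Hrho. assert (sup_bound b N rho <= sup_bound b N r)
        by (apply sup_bound_incr; auto; lra). lra.
Qed.

(** With M = 1 the coefficient inequality reads alpha + |a_(n,k)|^2 <= 1. *)
Lemma bounded_by_1_identity : (forall z, disk 1 z -> Cmod (F z) <= 1) ->
  forall z, disk 1 z -> F z = z.
Proof.
  intros HF1.
  assert (Hsq := fun k n => coef_square_bound 1 k n Rle_0_1 HF1).
  assert (Hb : b = 0%nat).
  { assert (H := Hsq 0%nat 2%nat ltac:(lia) ltac:(lia)).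
    assert (H1 := pow2_ge_0 (Cmod (a 2%nat 0%nat))).
    destruct b as [|b']; [reflexivity | exfalso].
    rewrite !S_INR in H. assert (H2 := pos_INR b'). lra. }
  intros z Hz. rewrite HF by exact Hz. rewrite Hb, sum_O. simpl Cpow. rewrite Cmult_1_l.
  apply Cmod_sub_0. apply Rle_antisym; [|apply Cmod_ge_0].
  apply Ccv_bound with (u := fun K => (psum (fun n => a n 0%nat) (S K) z - z)%C).
  - intros eps Heps. destruct (Hcv 0%nat ltac:(lia) z Hz eps Heps) as [n0 Hn0].
    exists n0. intros n Hn.
    replace (psum (fun n => a n 0%nat) (S n) z - z - (A 0%nat z - z))%C
      with (psum (fun n => a n 0%nat) (S n) z - A 0%nat z)%C by ring.
    apply Hn0. lia.
  - assert (Hzero : forall n, (2 <= n)%nat -> a n 0%nat = RtoC 0).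
    { intros n Hn. apply Cmod_eq_0.
      assert (H := Hsq 0%nat n ltac:(lia) Hn). rewrite Hb in H. simpl INR in H.
      assert (H1 := Cmod_ge_0 (a n 0%nat)). nra. }
    assert (E : forall K, psum (fun n => a n 0%nat) (S K) z = z).
    { induction K as [|K IH].
      - rewrite psum_S, psum_O, Ha0, Ha1 by lia. simpl. ring.
      - rewrite psum_S, IH, Hzero by lia. ring. }
    intros K. rewrite E. replace (z - z)%C with (RtoC 0) by ring. rewrite Cmod_0. lra.
Qed.
End Polyanalytic.

Theorem theorem3p1
    (alpha : nat) (halpha : (1 <= alpha)%nat)
    (A : nat -> C -> C) (a : nat -> nat -> C) (F : C -> C)
    (hA : forall k : nat, (k < alpha)%nat -> classA (A k))
    (ha : forall k : nat, (k < alpha)%nat -> forall z : C, disk 1 z ->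
       is_pseries (K := C_AbsRing) (V := C_NormedModule)
         (fun n => a n k) z (A k z))
    (hF : forall z : C, disk 1 z ->
       F z = sum_n (fun k => (Cpow (Cconj z) k * A k z)%C) (alpha - 1))
    (harg : forall k1 k2 n1 n2 : nat,
       (k1 < alpha)%nat -> (k2 < alpha)%nat ->
       (1 <= n1)%nat -> (1 <= n2)%nat -> k1 <> k2 -> n1 <> n2 ->
       a n1 k1 <> (RtoC 0) -> a n2 k2 <> (RtoC 0) ->
       Rabs (Arg (a n1 k1 / a n2 k2)%C) <= PI / 2) :
  (forall M : R, sqrt (INR alpha) <= M ->
     (forall z : C, disk 1 z -> Cmod (F z) <= M) ->
     (1 < M -> exists r1 : R,
        least_positive_root (radius_fun alpha M) r1 /\ r1 < 1) /\
     (forall r1 : R, least_positive_root (radius_fun alpha M) r1 ->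
        univalent_on (disk r1) F /\
        image_contains_schlicht_disk F (disk r1) (schlicht_radius alpha M r1))) /\
  ((forall z : C, disk 1 z -> Cmod (F z) <= 1) ->
     univalent_on (disk 1) F /\ maps_onto F (disk 1) (disk 1)).
Proof.
  destruct alpha as [|b]; [lia|].
  replace (S b - 1)%nat with b in hF by lia.
  assert (Hcv : forall k, (k <= b)%nat -> forall z, disk 1 z ->
    Ccv (fun K => psum (fun n => a n k) K z) (A k z)).
  { intros k Hk z Hz. apply is_pseries_psum, ha; [lia | exact Hz]. }
  assert (Ha01 : forall k, (k <= b)%nat -> a 0%nat k = RtoC 0 /\ a 1%nat k = RtoC 1).
  { intros k Hk. apply (classA_coefs (A k) (fun n => a n k)); [apply hA; lia | apply Hcv, Hk]. }
  assert (Ha0 := fun k Hk => proj1 (Ha01 k Hk)).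
  assert (Ha1 := fun k Hk => proj2 (Ha01 k Hk)).
  assert (Hsign : forall n n' k k', (k <= b)%nat -> (k' <= b)%nat -> k <> k' -> n <> n' ->
    0 <= Re (a n k * Cconj (a n' k'))%C).
  { intros n n' k k' Hk Hk' Hkk Hnn. apply Arg_quotient_sign. intros Hx Hy.
    assert (n <> 0%nat) by (intros ->; apply Hx, Ha0, Hk).
    assert (n' <> 0%nat) by (intros ->; apply Hy, Ha0, Hk').
    apply harg; auto; lia. }
  split.
  - intros M HM HFM. split.
    + apply radius_root_exists, HM.
    + intros r1. apply (univalent_schlicht b A a F); assumption.
  - intros HF1.
    assert (Hid := bounded_by_1_identity b A a F Ha0 Ha1 Hcv hF Hsign HF1).
    split.
    + intros z w Hz Hw E. now rewrite !Hid in E.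
    + intros w. split.
      * intros Hw. exists w. auto.
      * intros (z & Hz & <-). now rewrite Hid.
Qed.
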